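(* Let $(W,S)$ be an arbitrary Coxeter system (possibly of infinite rank) with Coxeter graph $\Gamma$, let $G$ be a group, let $\rho:G\to\mathrm{Aut}\,\Gamma$, $g\mapsto\rho_g$, be a group homomorphism, and let $W\rtimes G$ be the corresponding semidirect product. Let $\mathcal{O}_\rho\subseteq\mathcal{C}_W^{\mathrm{fin}}$ be the union of the $\rho^\dagger(G)$-orbits in $\mathcal{C}_W^{\mathrm{fin}}$ with finite cardinalities, and let $G_\rho$ be the set of all $h\in G_{\mathrm{ACI}}$ such that $\rho_h$ is the identity on all irreducible components of $W$ except a finite number of finite irreducible components. (1) Let $wg$ be an involution in $W\rtimes G$ with $w\in W$ and $g\in G$. Then $wg$ is almost central in $W\rtimes G$ if and only if $w\in W(\mathcal{O}_\rho)$ and $g\in G_\rho\cup\{1\}$. (2) We have $$\langle (W\rtimes G)_{\mathrm{ACI}}\rangle = W(\mathcal{O}_\rho)\rtimes\langle G_\rho\rangle .$$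
   Context: A Coxeter system $(W,S)$: $W$ is a group with presentation $\langle S\mid (st)^{m_{s,t}}=1 \text{ for } s,t\in S \text{ with } m_{s,t}<\infty\rangle$, where $m_{s,t}=m_{t,s}\in\{1,2,\dots\}\cup\{\infty\}$ and $m_{s,t}=1$ iff $s=t$. $S$ may be infinite. The Coxeter graph $\Gamma$ has vertex set $S$, with $s,t$ joined by an edge labelled $m_{s,t}$ iff $m_{s,t}\ge 3$. $\mathrm{Aut}\,\Gamma$ is the group of label-preserving graph automorphisms; each $\tau\in\mathrm{Aut}\,\Gamma$ extends uniquely to a group automorphism of $W$, also denoted $\tau$. In $W\rtimes G$ one has $(wg)(w'g')=w\rho_g(w')\cdot gg'$. For $I\subseteq S$, $W_I=\langle I\rangle$. An irreducible component of $W$ is a subgroup $W_I$ with $I$ (the vertex set of) a connected component of $\Gamma$; $W$ is the restricted direct product of its irreducible components. $\mathcal{C}_W^{\mathrm{fin}}$ is the set of the finite irreducible components of $W$. The $G$-action permutes $\mathcal{C}_W^{\mathrm{fin}}$, and $\rho^\dagger:G\to\mathrm{Sym}(\mathcal{C}_W^{\mathrm{fin}})$ is the induced permutation representation. For a set $\mathcal{C}$ of irreducible components, $W(\mathcal{C})$ is the (restricted direct) product of the components in $\mathcal{C}$, i.e. the subgroup of $W$ generated by them. An element $x$ of a group $H$ is almost central in $H$ if its centralizer $Z_H(x)$ has finite index in $H$. $H_{\mathrm{ACI}}$ is the set of all almost central involutions (elements of order exactly $2$) in $H$. $\langle X\rangle$ is the subgroup generated by $X$. *)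

(* Defs.v *)
From HB Require Import structures.
From mathcomp Require Import all_boot.
From mathcomp Require Import all_classical.

Set Implicit Arguments.
Unset Strict Implicit.
Unset Printing Implicit Defensive.

Local Open Scope classical_set_scope.
Local Open Scope group_scope.

Section GroupTheory.
Variable H : groupType.
Implicit Types (x y : H) (A X : set H).

Definition is_subgroup A := A 1 /\ (forall x y, A x -> A y -> A (x / y)).

Definition subgroup_gen X : set H := smallest is_subgroup X.

Definition centralizer x : set H := [set z | commute z x].

Definition finite_index A : Prop :=
  finite_set (range (fun x => [set x * a | a in A])).

Definition almost_central x : Prop := finite_index (centralizer x).

Definition involution x : Prop := x ^+ 2 = 1 /\ x <> 1.

Definition ACI : set H := [set x | involution x /\ almost_central x].

End GroupTheory.

Arguments ACI : clear implicits.

Record sym (T : Type) := Sym {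
  sym_fun :> T -> T;
  sym_inv : T -> T;
  sym_funK : cancel sym_fun sym_inv;
  sym_invK : cancel sym_inv sym_fun }.

Section SymGroup.
Variable T : Type.
Implicit Types f g h : sym T.

Lemma symP f g : f =1 g -> f = g.
Proof.
move=> efg; case: f g efg => f f' fK f'K [g g' gK g'K] /= efg.
have e : f = g by apply/funext.
have e' : f' = g' by apply/funext => x; rewrite -[x in LHS]g'K -efg fK.
by subst; congr Sym; apply: Prop_irrelevance.
Qed.

HB.instance Definition _ := gen_eqMixin (sym T).
HB.instance Definition _ := gen_choiceMixin (sym T).

Definition sym_one : sym T := @Sym T id id (frefl _) (frefl _).
Definition sym_V f : sym T := Sym (@sym_invK T f) (@sym_funK T f).

(* The product is composition, [(f * g) x = f (g x)], so that homomorphisms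
   into [sym T] are left actions (as opposed to [{perm T}]). *)
Definition sym_mul f g : sym T :=
  Sym (can_comp (@sym_funK T f) (@sym_funK T g))
      (can_comp (@sym_invK T g) (@sym_invK T f)).

Fact sym_mulA : associative sym_mul. Proof. by move=> f g h; apply: symP. Qed.
Fact sym_mul1 : left_id sym_one sym_mul.
Proof. by move=> f; apply: symP. Qed.
Fact sym_1mul : right_id sym_one sym_mul.
Proof. by move=> f; apply: symP. Qed.
Fact sym_mulV : left_inverse sym_one sym_V sym_mul.
Proof. by move=> f; apply: symP => x /=; rewrite sym_funK. Qed.
Fact sym_Vmul : right_inverse sym_one sym_V sym_mul.
Proof. by move=> f; apply: symP => x /=; rewrite sym_invK. Qed.

HB.instance Definition _ :=
  isGroup.Build (sym T) sym_mulA sym_mul1 sym_1mul sym_mulV sym_Vmul.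

End SymGroup.

Section GroupAut.
Variable W : groupType.

Definition is_group_aut : {pred sym W} :=
  [pred f : sym W | `[< {morph f : x y / x * y} >]].

Fact is_group_aut_group : group_closed is_group_aut.
Proof.
split=> [|f g]; first by apply/asboolP.
move=> /asboolP fM /asboolP gM; apply/asboolP => x y /=.
rewrite -fM; congr (f _); apply: (can_inj (@sym_funK _ g)).
by rewrite gM !sym_invK.
Qed.

Record group_aut := GroupAut {
  group_aut_sym :> sym W;
  group_aut_subproof : group_aut_sym \in is_group_aut }.

HB.instance Definition _ := [isSub for group_aut_sym].
HB.instance Definition _ := [Choice of group_aut by <:].
HB.instance Definition _ :=
  SubChoice_isSubGroup.Build (sym W) is_group_aut group_aut is_group_aut_group.

End GroupAut.

(* The parameter [phi] determines the group structure put on this type below. *)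
Record semidirect (W G : groupType) (phi : {multiplicative G -> group_aut W}) :=
  SDPair { sd_left : W; sd_right : G }.

Arguments SDPair {W G} phi sd_left sd_right.

Section Semidirect.
Variables (W G : groupType) (phi : {multiplicative G -> group_aut W}).
Local Notation semidirect := (semidirect phi).
Local Notation SDPair := (SDPair phi).

Definition semidirect_pair (x : semidirect) := (sd_left x, sd_right x).
Definition pair_semidirect (p : (W * G)%type) := SDPair p.1 p.2.

Fact semidirect_pairK : cancel semidirect_pair pair_semidirect.
Proof. by case. Qed.

HB.instance Definition _ := Choice.copy semidirect (can_type semidirect_pairK).

Definition sd_one := SDPair 1 1.
Definition sd_mul (x y : semidirect) :=
  SDPair (sd_left x * phi (sd_right x) (sd_left y)) (sd_right x * sd_right y).
Definition sd_inv (x : semidirect) :=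
  SDPair (phi (sd_right x)^-1 (sd_left x)^-1) (sd_right x)^-1.

Lemma group_autM (f : group_aut W) : {morph f : x y / x * y}.
Proof. by case: f => f /= /asboolP. Qed.

Lemma group_aut1 (f : group_aut W) : f 1 = 1.
Proof. by apply: (mulgI (f 1)); rewrite -group_autM !mulg1. Qed.

Lemma phiM g h x : phi (g * h) x = phi g (phi h x).
Proof. by rewrite gmulfM. Qed.

Lemma phi1 x : phi 1 x = x.
Proof.
by apply: (can_inj (@sym_funK _ (phi 1))); rewrite -phiM mulg1.
Qed.

Fact sd_mulA : associative sd_mul.
Proof.
by move=> x y z; rewrite /sd_mul /= group_autM phiM !mulgA.
Qed.
Fact sd_mul1 : left_id sd_one sd_mul.
Proof. by case=> w g; rewrite /sd_mul /= phi1 !mul1g. Qed.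
Fact sd_1mul : right_id sd_one sd_mul.
Proof. by case=> w g; rewrite /sd_mul /= group_aut1 !mulg1. Qed.
Fact sd_mulV : left_inverse sd_one sd_inv sd_mul.
Proof.
by case=> w g; rewrite /sd_mul /sd_inv /= -group_autM !mulVg group_aut1.
Qed.
Fact sd_Vmul : right_inverse sd_one sd_inv sd_mul.
Proof.
by case=> w g; rewrite /sd_mul /sd_inv /= -phiM !mulgV phi1 mulgV.
Qed.

HB.instance Definition _ :=
  isGroup.Build semidirect sd_mulA sd_mul1 sd_1mul sd_mulV sd_Vmul.

(* The subset [A B] of [W ><| G], for [A] in [W] and [B] in [G]; it is the
   semidirect product of the subgroups [A] and [B] when it is a subgroup. *)
Definition sd_set (A : set W) (B : set G) : set semidirect :=
  [set x | A (sd_left x) /\ B (sd_right x)].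

End Semidirect.

(* The value [M s t = 0] stands for an infinite label. *)
Record coxeter_matrix (S : Type) := CoxeterMatrix {
  cox_m :> S -> S -> nat;
  cox_mC : forall s t, cox_m s t = cox_m t s;
  cox_m1 : forall s t, cox_m s t = 1%N <-> s = t }.

Section CoxeterGraph.
Variables (S : Type) (M : coxeter_matrix S).

Definition cox_edge : rel S := fun s t => (M s t == 0%N) || (2 < M s t)%N.

Definition graph_component (s : S) : set S :=
  [set t | exists2 p, path cox_edge s p & t = last s p].

Definition is_graph_aut : {pred sym S} :=
  [pred f : sym S | `[< forall s t,
     cox_edge (f s) (f t) = cox_edge s t /\
     (cox_edge s t -> M (f s) (f t) = M s t) >]].

Lemma graph_aut_cox_m (f : sym S) s t :
  f \in is_graph_aut -> M (f s) (f t) = M s t.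
Proof.
move=> /asboolP /(_ s t) [].
have [_ _ /(_ isT) //|] := boolP (cox_edge s t).
have [<-|ne_st] := pselect (s = t).
  by move=> *; rewrite (cox_m1 M _ _).2 // (cox_m1 M _ _).2.
have ne_fst : f s <> f t by move/(can_inj (@sym_funK _ f)).
rewrite /cox_edge.
move: ne_st ne_fst; rewrite -!(cox_m1 M).
by move: (M s t) (M (f s) (f t)) => [|[|[|?]]] // [|[|[|?]]].
Qed.

Fact is_graph_aut_group : group_closed is_graph_aut.
Proof.
split=> [|f g]; first by apply/asboolP.
move=> fP gP; apply/asboolP => s t /=.
have e : M (f (sym_inv g s)) (f (sym_inv g t)) = M s t.
  by rewrite graph_aut_cox_m // -(graph_aut_cox_m _ _ gP) !sym_invK.
by rewrite /cox_edge /= e.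
Qed.

Record graph_aut := GraphAut {
  graph_aut_sym :> sym S;
  graph_aut_subproof : graph_aut_sym \in is_graph_aut }.

HB.instance Definition _ := [isSub for graph_aut_sym].
HB.instance Definition _ := [Choice of graph_aut by <:].
HB.instance Definition _ :=
  SubChoice_isSubGroup.Build (sym S) is_graph_aut graph_aut is_graph_aut_group.

End CoxeterGraph.

Record coxeter_system (S : Type) (M : coxeter_matrix S) (W : groupType) :=
  CoxeterSystem {
    cox_gen :> S -> W;
    (* For [M s t = 0] the relation is the trivial one [1 = 1]. *)
    cox_rel : forall s t, (cox_gen s * cox_gen t) ^+ M s t = 1;
    (* Universal property of the group presented by [S] and these relations. *)
    cox_univ : forall (H : groupType) (f : S -> H),
      (forall s t, (f s * f t) ^+ M s t = 1) ->
      exists! F : W -> H,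
        {morph F : x y / x * y} /\ (forall s, F (cox_gen s) = f s) }.

Section CoxeterAut.
Variables (S : Type) (M : coxeter_matrix S) (W : groupType).
Variable cs : coxeter_system M W.

Lemma cox_hom_eq (H : groupType) (F F' : W -> H) :
  {morph F : x y / x * y} -> {morph F' : x y / x * y} ->
  (forall s, F (cs s) = F' (cs s)) -> F = F'.
Proof.
move=> FM F'M eF.
have F1 : F 1 = 1 by apply: (mulgI (F 1)); rewrite -FM !mulg1.
have rel s t : (F (cs s) * F (cs t)) ^+ M s t = 1.
  rewrite -FM -F1 -(cox_rel cs s t); move: (cs s * cs t) => x.
  by elim: (M s t) => [|n IHn]; rewrite ?expg0 ?F1 // !expgS FM IHn.
have [F0 [_ F0P]] := cox_univ cs rel.
by rewrite -(F0P F) //; apply: F0P; split=> [|s]; rewrite ?eF.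
Qed.

Lemma cox_ext_subproof (tau : graph_aut M) :
  exists F : W -> W, {morph F : x y / x * y} /\
                     (forall s, F (cs s) = cs (tau s)).
Proof.
have [s t|F [FP _]] := @cox_univ _ _ _ cs W (cs \o tau); last by exists F.
by rewrite /= -(graph_aut_cox_m s t (graph_aut_subproof tau)) cox_rel.
Qed.

Definition cox_ext (tau : graph_aut M) : W -> W :=
  projT1 (cid (cox_ext_subproof tau)).

Lemma cox_extM tau : {morph cox_ext tau : x y / x * y}.
Proof. by rewrite /cox_ext; case: cid => F []. Qed.

Lemma cox_ext_gen tau s : cox_ext tau (cs s) = cs (tau s).
Proof. by rewrite /cox_ext; case: cid => F []. Qed.

Lemma cox_ext_comp tau tau' :
  cox_ext (tau * tau') = cox_ext tau \o cox_ext tau'.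
Proof.
apply: cox_hom_eq => [|x y /=|s]; rewrite ?cox_extM //; first exact: cox_extM.
by rewrite /= !cox_ext_gen.
Qed.

Lemma cox_ext1 : cox_ext 1 = id.
Proof.
by apply: cox_hom_eq => [|//|s]; [exact: cox_extM | rewrite cox_ext_gen].
Qed.

Fact cox_ext_funK tau : cancel (cox_ext tau) (cox_ext tau^-1).
Proof.
by move=> x; rewrite -[LHS]/((_ \o _) x) -cox_ext_comp mulVg cox_ext1.
Qed.

Fact cox_ext_invK tau : cancel (cox_ext tau^-1) (cox_ext tau).
Proof.
by move=> x; rewrite -[LHS]/((_ \o _) x) -cox_ext_comp mulgV cox_ext1.
Qed.

Fact cox_aut_subproof tau :
  Sym (cox_ext_funK tau) (cox_ext_invK tau) \in @is_group_aut W.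
Proof. by apply/asboolP/cox_extM. Qed.

(* The automorphism of [W] extending a graph automorphism. *)
Definition cox_aut (tau : graph_aut M) : group_aut W :=
  GroupAut (cox_aut_subproof tau).

Fact cox_aut_multiplicative : {morph cox_aut : tau tau' / tau * tau'}.
Proof.
by move=> tau tau'; apply/val_inj/symP => x /=; rewrite cox_ext_comp.
Qed.

HB.instance Definition _ :=
  isMultiplicative.Build (graph_aut M) (group_aut W) cox_aut
    cox_aut_multiplicative.

Definition parabolic (I : set S) : set W := subgroup_gen (cs @` I).

Definition irr_component : set (set W) :=
  range (fun s => parabolic (graph_component M s)).

Definition fin_irr_component : set (set W) :=
  irr_component `&` [set C | finite_set C].

(* [W(CC)] for a set [CC] of irreducible components. *)
Definition component_prod (CC : set (set W)) : set W :=
  subgroup_gen (\bigcup_(C in CC) C).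

Section Action.
Variables (G : groupType) (rho : {multiplicative G -> graph_aut M}).

Definition cox_act : {multiplicative G -> group_aut W} := cox_aut \o rho.

Definition rho_dagger (g : G) (C : set W) : set W := cox_act g @` C.

Definition rho_orbit (C : set W) : set (set W) :=
  range (fun g => rho_dagger g C).

Definition O_rho : set (set W) :=
  [set C | fin_irr_component C /\ finite_set (rho_orbit C)].

Definition G_rho : set G :=
  [set h | ACI G h /\
     exists E : set (set W),
       [/\ E `<=` fin_irr_component, finite_set E &
           forall C, irr_component C -> ~ E C ->
             forall w, C w -> cox_act h w = w]].

End Action.
End CoxeterAut.

(* Main.v *)
(* Let [w g] be an almost central involution and [F] the automorphism of [W]
   induced by [g]; the twisted class of the [v w F(v)^-1] is finite.  Let [u] be a
   longest element of it and [K] the set of the [s] with [l(s u) > l(u)]; then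
   [s u = u F(s)] for [s] in [K], by the folding condition.  It follows, by the
   argument showing that an element with all descents is a longest one, that
   every element of [W] is a suffix of an element of [W_K u] for the weak order,
   so [W_K] has finite index in [W].  Let [N] be the normal core of [W_K] and [K0]
   the set of the letters of the reduced words of its elements.  For [r] outside
   [K0] and [n] in [N], both [n] and [r n r] lie in [W_K0], which forces
   [r n = n r]; thus [r] commutes with [K0].  So [I], the complement of [K0], is a
   union of components, and [W_I] is finite because it embeds into [W / N].
   Moreover [u] has no descent in [K0], hence it lies in [W_I], commutes with
   [K0], and [F] fixes [K0] pointwise.  Hence [w] is in [W_I] as well.

   The components met by [w] have finite orbits because the conjugates of [w g]
   by [G] are finitely many.  Conversely, elements with finitely many conjugates
   form a subgroup.

   The exchange condition comes from an action of [W] on [W * bool], and the fact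
   that adjacent generators do not commute from the reflection representation
   over the algebraic numbers. *)

Require Import Defs.
From mathcomp Require Import all_boot.
From mathcomp Require Import all_classical.
From mathcomp Require ssralg poly ssrnum algC cyclotomic.
From mathcomp Require Import zify ring.

Set Implicit Arguments.
Unset Strict Implicit.
Unset Printing Implicit Defensive.

Local Open Scope classical_set_scope.
Local Open Scope group_scope.

(** * Subgroups and conjugacy classes *)

Section Subgroups.
Variable H : groupType.
Implicit Types (x y z : H) (A B C X : set H).

Lemma subgroup_genP X : is_subgroup (subgroup_gen X).
Proof.
split=> [A [[A1 _] _]//|x y gx gy A AP].
by case: (AP) => -[_ AF] _; apply: AF; [exact: gx | exact: gy].
Qed.

Lemma sub_subgroup_gen X : X `<=` subgroup_gen X.
Proof. exact: sub_gen_smallest. Qed.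

Lemma subgroup_gen_sub X A : is_subgroup A -> X `<=` A -> subgroup_gen X `<=` A.
Proof. exact: smallest_sub. Qed.

Lemma subgroupV A x : is_subgroup A -> A x -> A x^-1.
Proof. by case=> A1 AF Ax; rewrite -[x^-1]mul1g; exact: AF. Qed.

Lemma subgroupM A x y : is_subgroup A -> A x -> A y -> A (x * y).
Proof.
by move=> sA Ax Ay; rewrite -[y]invgK; apply: sA.2 => //; exact: subgroupV.
Qed.

Lemma finite_injective (T U : Type) (f : T -> U) (B : set T) :
  {in B &, injective f} -> finite_set (f @` B) -> finite_set B.
Proof. by move=> /inj_card_eq/eq_finite_set ->. Qed.

(* If [A] has finite index then so has its normal core, the kernel of the
   permutation action on the cosets. *)
Lemma finite_mod_core A B C : is_subgroup A -> finite_set C ->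
    (forall z, exists a c, [/\ A a, C c & z = a * c]) ->
    (forall x y, B x -> B y -> (forall v, A (v * (x / y) / v)) -> x = y) ->
  finite_set B.
Proof.
move=> sA /finite_seqP[cs Ccs] cover inj.
pose idx z := find (fun c => `[< A (z / c) >]) cs.
have idx_lt z : idx z < size cs.
  rewrite -has_find; have [a [c [Aa Cc ->]]] := cover z.
  apply/hasP; exists c; last by rewrite mulgK; apply/asboolP.
  by move: Cc; rewrite Ccs.
have idxP z : A (z / nth 1 cs (idx z)).
  apply/asboolP; apply: (nth_find 1 (a := fun c => `[< A (z / c) >])).
  by rewrite has_find idx_lt.
pose f v : {ffun 'I_(size cs) -> 'I_(size cs)} :=
  [ffun i : 'I_(size cs) => Ordinal (idx_lt (nth 1 cs i * v))].
apply: (@finite_injective _ _ f); last exact: finite_finset.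
move=> x y /set_mem Bx /set_mem By fxy; apply: inj => // v.
have [a [c [Aa Cc ->]]] := cover v.
have ci : index c cs < size cs by rewrite index_mem; move: Cc; rewrite Ccs.
move/ffunP/(_ (Ordinal ci))/(congr1 val): fxy.
rewrite !ffunE /= nth_index; last by move: Cc; rewrite Ccs.
move=> ei; have := idxP (c * x); rewrite ei => Ax; have Ay := idxP (c * y).
have := sA.2 _ _ Ax Ay; rewrite mulgKA invgM !mulgA => Axy.
by rewrite invgM !mulgA; apply: (subgroupM sA) (subgroupV sA Aa);
   rewrite -!mulgA; apply: subgroupM => //; rewrite !mulgA.
Qed.

(** The coset of [z] modulo the centralizer consists of the elements conjugating [x] to [z * x / z],
    so cosets and conjugates correspond bijectively. *)
Lemma almost_centralP x :
  almost_central x <-> finite_set (range (fun z => z * x / z)).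
Proof.
pose h c := [set y | y * x / y = c].
have cosetE z : [set z * a | a in centralizer x] = h (z * x / z).
  apply/seteqP; split=> [_ [a ax <-]|y /= yz].
    by rewrite /h /= -(mulgA z) ax invgM !mulgA mulgK.
  exists (z^-1 * y); rewrite ?mulVKg // /centralizer /= /commute.
  apply: (mulgI z); rewrite -!mulgA mulVKg; apply: (mulIg y^-1).
  by rewrite !mulgA yz mulgK.
have e : range (fun z => [set z * a | a in centralizer x]) =
    h @` range (fun z => z * x / z).
  by rewrite image_comp; apply: eq_imagel => z _; rewrite cosetE.
rewrite /almost_central /finite_index e; split; last exact: finite_image.
apply: finite_injective => c d /set_mem[z _ zc] /set_mem _ hcd.
have : h c z by [].
by rewrite hcd => <-.
Qed.

Lemma subgroup_almost_central : is_subgroup (@almost_central H).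
Proof.
split=> [|x y].
  apply/almost_centralP; apply: sub_finite_set (finite_set1 1) => _ [z _ <-].
  by rewrite mulg1 mulgV.
rewrite !almost_centralP => fx fy.
apply: sub_finite_set (finite_image2 (fun a b => a / b) fx fy) => _ [z _ <-].
exists (z * x / z); first by exists z.
exists (z * y / z); first by exists z.
by rewrite !invgM invgK !mulgA mulgVK.
Qed.

Lemma finite_normal_join (E : set (set H)) : finite_set E ->
    (forall C, E C -> [/\ is_subgroup C, finite_set C &
       forall v x, C x -> C (v * x / v)]) ->
  exists Q, [/\ is_subgroup Q, finite_set Q,
    forall v x, Q x -> Q (v * x / v) & forall C, E C -> C `<=` Q].
Proof.
move=> /finite_seqP[l ->]; elim: l => [|C l IHl] lP.
  exists [set 1]; split=> [|//|v x ->|//]; last by rewrite /= mulg1 mulgV.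
  by split=> // x y -> ->; rewrite /= mulgV.
have [|Q [sQ fQ nQ lQ]] := IHl.
  by move=> D Dl; apply: lP; rewrite /= inE Dl orbT.
have [|sC fC nC] := lP C; first by rewrite /= mem_head.
exists [set q * c | q in Q & c in C]; split.
- split=> [|_ _ [q Qq [c Cc <-]] [q' Qq' [c' Cc' <-]]].
    by exists 1; [exact: sQ.1 | exists 1; [exact: sC.1 | rewrite mulg1]].
  exists (q / q'); first exact: sQ.2.
  exists (q' * (c / c') / q'); first exact/nC/sC.2.
  by rewrite invgM !mulgA mulgVK.
- exact: finite_image2.
- move=> v _ [q Qq [c Cc <-]]; exists (v * q / v); first exact: nQ.
  by exists (v * c / v); [exact: nC | rewrite !mulgA mulgVK].
move=> D; rewrite /= inE => /orP[/eqP-> x Cx|/lQ DQ x /DQ Qx].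
  by exists 1; [exact: sQ.1 | exists x; rewrite ?mul1g].
by exists x => //; exists 1; [exact: sC.1 | rewrite mulg1].
Qed.

Lemma preimage_subgroup (K : groupType) (f : K -> H) A :
  {morph f : x y / x * y} -> is_subgroup A -> is_subgroup (f @^-1` A).
Proof.
move=> fM [A1 AF]; have f1 : f 1 = 1 by apply: (mulgI (f 1)); rewrite -fM !mulg1.
split=> [|x y Ax Ay]; first by rewrite /preimage /= f1.
have fV : f y^-1 = (f y)^-1 by apply: (mulgI (f y)); rewrite -fM !mulgV.
by rewrite /preimage /= fM fV; exact: AF.
Qed.

End Subgroups.

(** * The reflection representation *)

Module Reflection.
Import ssralg poly ssrnum algC cyclotomic GRing.Theory.
Local Open Scope ring_scope.

Section Reflection.
Variables (S : Type) (M : coxeter_matrix S).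

(* Of order exactly [2 m] for [m > 0]; the junk value at [m = 0] is a
   legitimate choice for an infinite label. *)
Definition zeta (m : nat) : algC :=
  if m is m'.+1 then projT1 (C_prim_root_exists (ltn0Sn (m' + m'.+1))) else 1.

Lemma zetaP m : (0 < m)%N -> (m + m).-primitive_root (zeta m).
Proof. by case: m => // m _; rewrite /zeta; case: C_prim_root_exists. Qed.

Lemma zeta_neq0 m : zeta m != 0.
Proof.
case: m => [|m]; first exact: oner_neq0.
have /prim_expr_order := zetaP (ltn0Sn m); apply: contra_eqN => /eqP->.
by rewrite addnS expr0n eq_sym oner_eq0.
Qed.

(* [- 2 cos (pi / m)], up to a Galois automorphism *)
Definition cartan s t : algC := - (zeta (M s t) + (zeta (M s t))^-1).

Lemma cartanC s t : cartan s t = cartan t s.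
Proof. by rewrite /cartan cox_mC. Qed.

Lemma cartan_diag s : cartan s s = 2.
Proof.
rewrite /cartan (cox_m1 M s s).2 //.
have z2 := prim_expr_order (zetaP (ltn0Sn 0)).
have : (zeta 1 - 1) * (zeta 1 + 1) = 0 by rewrite -subr_sqr z2 expr1n subrr.
move/eqP; rewrite mulf_eq0 subr_eq0 addr_eq0 => /orP[] /eqP z1.
  have := zetaP (ltn0Sn 0); rewrite z1 => /andP[_ /forallP/(_ ord0)].
  by rewrite unity_rootE expr1n eqxx.
by rewrite z1 invrN1 opprD opprK.
Qed.

Lemma cartan_edge s t : cox_edge M s t -> cartan s t != 0.
Proof.
rewrite /cox_edge /cartan oppr_eq0; case: (M s t) => [_|m /= m2].
  by rewrite /= invr1 -(natrD _ 1 1) Num.Theory.pnatr_eq0.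
have z0 := zeta_neq0 m.+1; apply/negP => /eqP z.
have z2 : zeta m.+1 ^+ 2 = -1.
  by apply/eqP; rewrite -addr_eq0 expr2 -(mulfV z0) -mulrDr z mulr0.
have : (m.+1 + m.+1 %| 4)%N.
  by rewrite (prim_order_dvd (zetaP _)) // (exprM _ 2 2) z2 sqrrN expr1n.
by move/dvdn_leq => /(_ isT); lia.
Qed.

(** The contragredient action: [f] lists the values of a linear form on the simple roots, and the
    root of [u] is sent to itself minus [cartan s u] times the root of [s]. *)
Definition refl_fun s (f : S -> algC) : S -> algC :=
  fun u => f u - f s * cartan s u.

Lemma refl_funK s : involutive (refl_fun s).
Proof.
move=> f; apply/funext => u; rewrite /refl_fun cartan_diag; ring.
Qed.

Definition refl s := Sym (refl_funK s) (refl_funK s).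

Lemma refl2 s : (refl s * refl s = 1)%g.
Proof. by apply: symP => f; exact: refl_funK. Qed.

Section Rank2.
Variables (s t : S) (f : S -> algC).
Let rot n := ((refl s * refl t)%g ^+ n)%g f.
Let x n := rot n s.
Let y n := rot n t.
Let z := zeta (M s t).
Let c := z + z^-1.

Let rotS n u : rot n.+1 u = rot n u - y n * cartan t u - (x n + c * y n) * cartan s u.
Proof.
rewrite /x /y /rot expgS /= /refl_fun (cartanC t s) /cartan -/z -/c; ring.
Qed.

(** The roots of this quadratic are [z] and [z^-1]; for each of them [x + e y] is multiplied by
    [e ^+ 2] at every rotation. *)
Let eigen (e : algC) n : e ^+ 2 - c * e + 1 = 0 ->
  x n + e * y n = (e ^+ 2) ^+ n * (x 0 + e * y 0).
Proof.
move=> e2; elim: n => [|n IHn]; first by rewrite mul1r.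
rewrite exprS -mulrA -IHn /x /y !rotS -/(x n) -/(y n) !cartan_diag.
rewrite (cartanC t s) /cartan -/z -/c.
have -> : e ^+ 2 = c * e - 1 by apply/eqP; rewrite -subr_eq0 -e2; apply/eqP; ring.
apply/eqP; rewrite -subr_eq0; apply/eqP.
transitivity (- (c * y n) * (e ^+ 2 - c * e + 1)); last by rewrite e2 mulr0.
ring.
Qed.

(** By [rotE] the displacement after [m] rotations only involves the sums of the [x i] and of the
    [y i]. For [e = z] and [e = z^-1] the terms [x i + e * y i] form a geometric series of sum zero,
    [e ^+ 2] being a nontrivial [m]-th root of unity. As [z] and [z^-1] differ, both sums vanish. *)
Lemma refl_rot : (1 < M s t)%N -> ((refl s * refl t)%g ^+ M s t)%g f = f.
Proof.
move=> m1; have m0 := ltnW m1; have z0 := zeta_neq0 (M s t).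
set m := M s t in m1 m0 z0 *.
have pz : (m + m).-primitive_root z := zetaP m0.
have z2N1 : z ^+ 2 - 1 != 0.
  rewrite subr_eq0; apply/negP => /eqP z2.
  have : (m + m %| 2)%N by rewrite (prim_order_dvd pz) z2.
  by move/dvdn_leq => /(_ isT); lia.
have z2m : (z ^+ 2) ^+ m = 1 by rewrite -exprM mul2n -addnn prim_expr_order.
have geom (e : algC) : e - 1 != 0 -> e ^+ m = 1 -> \sum_(i < m) e ^+ i = 0.
  move=> e1 em; apply: (mulfI e1); rewrite mulr0 -subrX1 em subrr //.
have sumE e : e ^+ 2 - c * e + 1 = 0 -> e ^+ 2 - 1 != 0 -> (e ^+ 2) ^+ m = 1 ->
    \sum_(i < m) x i + e * \sum_(i < m) y i = 0.
  move=> e2 e1 em; rewrite mulr_sumr -big_split /=.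
  by under eq_bigr => i _ do rewrite eigen //; rewrite -mulr_suml geom ?mul0r.
have e1 := sumE z.
have e2 := sumE z^-1.
have {e1} e1 : \sum_(i < m) x i + z * \sum_(i < m) y i = 0.
  by apply: e1 => //; rewrite /c; field.
have {e2} e2 : \sum_(i < m) x i + z^-1 * \sum_(i < m) y i = 0.
  apply: e2; first by rewrite /c; field.
    apply: contra z2N1 => /eqP h; apply/eqP.
    by rewrite -[RHS](mulr0 (- z ^+ 2)) -h; field.
  by rewrite exprVn exprVn z2m invr1.
have Y0 : \sum_(i < m) y i = 0.
  apply: (mulfI z2N1); rewrite mulr0.
  transitivity (z * ((\sum_(i < m) x i + z * \sum_(i < m) y i) -
    (\sum_(i < m) x i + z^-1 * \sum_(i < m) y i))); last by rewrite e1 e2 subrr mulr0.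
  by field.
have X0 : \sum_(i < m) x i = 0 by move: e1; rewrite Y0 mulr0 addr0.
apply/funext => u.
have rotE n : rot n u = f u - (\sum_(i < n) y i) * cartan t u -
    (\sum_(i < n) x i + c * \sum_(i < n) y i) * cartan s u.
  elim: n => [|n IHn]; first by rewrite !big_ord0 /rot /=; ring.
  by rewrite rotS IHn !big_ord_recr /=; ring.
by have := rotE m; rewrite X0 Y0 /rot => ->; ring.
Qed.

End Rank2.

Lemma refl_rel s t : ((refl s * refl t) ^+ M s t = 1)%g.
Proof.
case: (ltngtP 1 (M s t)) => [m1|m1|m1].
- by apply: symP => f; exact: refl_rot.
- by case: (M s t) m1 => // -[].
- by rewrite -m1 expg1 (cox_m1 M s t).1 // refl2.
Qed.

Lemma refl_inj s t : refl s = refl t -> s = t.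
Proof.
move=> est; apply: contrapT => st.
pose f u : algC := if `[< u = s >] then 1 else 0.
have : refl s f s = refl t f s by rewrite est.
rewrite /= /refl_fun cartan_diag /f asboolT // asboolF; last by move=> ets; apply: st.
move/eqP; rewrite -subr_eq0 mul1r mul0r subr0.
rewrite [X in X == _](_ : _ = - 2); last by ring.
by rewrite oppr_eq0 Num.Theory.pnatr_eq0.
Qed.

(** Applied to the indicator function of [t], the two products differ at [s] by [2 * cartan s t]. *)
Lemma refl_comm s t : commute (refl s) (refl t) -> s <> t -> ~~ cox_edge M s t.
Proof.
move=> est st; apply/negP => /cartan_edge cst.
pose f u : algC := if `[< u = t >] then 1 else 0.
have : (refl s * refl t)%g f s = (refl t * refl s)%g f s by rewrite est.
rewrite /= /refl_fun !cartan_diag /f (asboolT (erefl t)) asboolF // (cartanC t s).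
move/eqP; rewrite -subr_eq0.
rewrite [X in X == _](_ : _ = 2 * cartan s t); last by ring.
by rewrite mulf_eq0 (negPf cst) Num.Theory.pnatr_eq0.
Qed.

End Reflection.

Section CoxeterReflection.
Variables (S : Type) (M : coxeter_matrix S) (W : groupType).
Variable cs : coxeter_system M W.

Let refl_hom : exists2 F : W -> sym (S -> algC),
  {morph F : x y / (x * y)%g} & forall s, F (cs s) = refl M s.
Proof. by have [F [[FM Fs] _]] := cox_univ cs (refl_rel M); exists F. Qed.

Lemma cox_gen_inj : injective cs.
Proof.
have [F _ Fs] := refl_hom => s t est.
by apply: (@refl_inj _ M); rewrite -!Fs est.
Qed.

Lemma cox_gen_comm s t : commute (cs s) (cs t) -> s <> t -> ~~ cox_edge M s t.
Proof.
have [F FM Fs] := refl_hom => est.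
by apply: refl_comm; rewrite /commute -!Fs -!FM est.
Qed.

End CoxeterReflection.
End Reflection.
Import Reflection (cox_gen_inj, cox_gen_comm).

(** * Length and the exchange condition *)

Section Words.
Variables (S : Type) (M : coxeter_matrix S) (W : groupType).
Variable cs : coxeter_system M W.
Implicit Types (s t r : S) (a b c : seq S) (w x y z : W) (I J : set S).

Lemma cox_gen2 s : cs s * cs s = 1.
Proof. by have := cox_rel cs s s; rewrite (cox_m1 M s s).2. Qed.

Lemma cox_genV s : (cs s)^-1 = cs s.
Proof. exact/mulg1_eq/cox_gen2. Qed.

Lemma cox_genK s : involutive (mul (cs s)).
Proof. by move=> w; rewrite mulgA cox_gen2 mul1g. Qed.

Lemma cox_genKr s w : w * cs s * cs s = w.
Proof. by rewrite -mulgA cox_gen2 mulg1. Qed.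

Lemma cox_edgeN s t : s <> t -> ~~ cox_edge M s t -> commute (cs s) (cs t).
Proof.
move=> st; have := cox_rel cs s t; have := (cox_m1 M s t).1.
rewrite /cox_edge; case: (M s t) => [|[|[|m]]] //; first by move=> /(_ erefl).
rewrite expg2 => _ st2 _.
by apply: (mulIg (cs s * cs t)); rewrite st2 -mulgA cox_genK cox_gen2.
Qed.

Fixpoint wprod a : W := if a is s :: a' then cs s * wprod a' else 1.

Lemma wprod_cat a b : wprod (a ++ b) = wprod a * wprod b.
Proof. by elim: a => [|s a IHa] /=; rewrite ?mul1g // IHa mulgA. Qed.

Lemma wprod_rcons a s : wprod (rcons a s) = wprod a * cs s.
Proof. by rewrite -cats1 wprod_cat /= mulg1. Qed.

Lemma wprod_rev a : wprod (rev a) = (wprod a)^-1.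
Proof.
elim: a => [|s a IHa]; first by rewrite invg1.
by rewrite rev_cons wprod_rcons IHa /= invgM cox_genV.
Qed.

(* Translations commute with the swap of the sheets of [W * bool] over the
   subgroup generated by [S], since the generators do. *)
Lemma wprod_surj w : exists a, wprod a = w.
Proof.
pose A := range wprod.
have As s x : A (cs s * x) = A x.
  apply/propext; split=> [] [a _ ax].
    by exists (s :: a); rewrite //= ax cox_genK.
  by exists (s :: a); rewrite //= ax.
pose swap (p : W * bool) := (p.1, p.2 (+) `[< A p.1 >]).
have swapK : cancel swap swap.
  by move=> [x e]; rewrite /swap /= -addbA addbb addbF.
pose sigma := Sym swapK swapK.
have transK x : cancel (fun p : W * bool => (x * p.1, p.2))
                       (fun p => (x^-1 * p.1, p.2)).
  by move=> [y e] /=; rewrite mulKg.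
have transVK x : cancel (fun p : W * bool => (x^-1 * p.1, p.2))
                       (fun p => (x * p.1, p.2)).
  by move=> [y e] /=; rewrite mulVKg.
pose L x := Sym (transK x) (transVK x).
have LM : {morph L : x y / x * y}.
  by move=> x y; apply: symP => p /=; rewrite mulgA.
have sigma2 : sigma * sigma = 1 by apply: symP => p; exact: swapK.
have : L = (fun x => sigma * L x * sigma).
  apply: (cox_hom_eq (cs := cs) LM) => [x y|s].
    by rewrite LM !mulgA -(mulgA (sigma * L x) sigma sigma) sigma2 mulg1.
  apply: symP => -[x e]; rewrite /= /swap /= As -addbA addbb addbF //.
move/(congr1 (fun F => sym_fun (F w) (1, false))) => /=.
rewrite /swap /= (asboolT (P := A 1)); last by exists [::].
by rewrite !mulg1; case: asboolP => // -[a _ aw] _; exists a.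
Qed.

Fact len_exists w : exists n, `[< exists2 a, size a = n & wprod a = w >].
Proof. by have [a aw] := wprod_surj w; exists (size a); apply/asboolP; exists a. Qed.

Definition len w := ex_minn (len_exists w).

Lemma reduced_word w : exists2 a, size a = len w & wprod a = w.
Proof. by rewrite /len; case: ex_minnP => n /asboolP. Qed.

Lemma len_wprod a : len (wprod a) <= size a.
Proof. by rewrite /len; case: ex_minnP => n _; apply; apply/asboolP; exists a. Qed.

Lemma len1 : len 1 = 0.
Proof. by apply/eqP; rewrite -leqn0 (len_wprod [::]). Qed.

Lemma len_eq0 w : len w = 0 -> w = 1.
Proof. by move=> w0; have [a] := reduced_word w; rewrite w0; case: a => // _ <-. Qed.

Lemma lenV w : len w^-1 = len w.
Proof.
suff le x : len x^-1 <= len x by apply/eqP; rewrite eqn_leq le -{1}[w]invgK le.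
have [a <- <-] := reduced_word x.
by rewrite -wprod_rev -[size a]size_rev len_wprod.
Qed.

Lemma lenM x y : len (x * y) <= len x + len y.
Proof.
have [[a <- ax] [b <- bx]] := (reduced_word x, reduced_word y).
by rewrite -ax -bx -wprod_cat -size_cat len_wprod.
Qed.

Lemma len_gen_le s : len (cs s) <= 1.
Proof. by rewrite -[cs s]mulg1 (len_wprod [:: s]). Qed.

Lemma len_mulr_le w s : len (w * cs s) <= (len w).+1.
Proof. by rewrite (leq_trans (lenM _ _)) // -addn1 leq_add2l len_gen_le. Qed.

Lemma len_mull_le s w : len (cs s * w) <= (len w).+1.
Proof. by rewrite (leq_trans (lenM _ _)) // -add1n leq_add2r len_gen_le. Qed.

(** When [p.1] is a reflection, [p] stands for a root with sign [p.2]: up to sign, the root of [s]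
    is the only one whose sign [s] changes. *)
Definition flip_fun s (p : W * bool) := (cs s * p.1 * cs s, p.2 (+) (p.1 == cs s)).

Lemma flip_funK s : involutive (flip_fun s).
Proof.
move=> [x e]; rewrite /flip_fun /=.
have -> : (cs s * x * cs s == cs s) = (x == cs s).
  rewrite -[X in _ == X]mul1g (inj_eq (mulIg _)) -(cox_gen2 s).
  by rewrite (inj_eq (mulgI _)).
by rewrite -!mulgA cox_gen2 mulg1 cox_genK -addbA addbb addbF.
Qed.

Definition flip s := Sym (flip_funK s) (flip_funK s).

Lemma flip_rel s t : (flip s * flip t) ^+ M s t = 1.
Proof.
set m := M s t; set d := cs s * cs t.
have dm : d ^+ m = 1 := cox_rel cs s t.
have dV : d^-1 = cs t * cs s by rewrite invgM !cox_genV.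
(* [t] inverts [d], so the conjugates of [t] and [t s t] by the powers of [d]
   are the [d^-i t]; each of them is met twice as [i] runs up to [2 m]. *)
have tdX n : cs t * d ^+ n = d^-1 ^+ n * cs t.
  elim: n => [|n IHn]; first by rewrite !expg0 mulg1 mul1g.
  by rewrite expgSr mulgA IHn [in RHS]expgSr dV -!mulgA.
have conjE x y n : (d ^+ n * x * d^-1 ^+ n == y) = (x == d^-1 ^+ n * y * d ^+ n).
  have dn : d^-1 ^+ n * d ^+ n = 1 by rewrite expVgn mulVg.
  have dn' : d ^+ n * d^-1 ^+ n = 1 by rewrite expVgn mulgV.
  apply/eqP/eqP => [<-|->]; rewrite !mulgA.
    by rewrite dn mul1g -mulgA dn mulg1.
  by rewrite dn' mul1g -mulgA dn' mulg1.
pose c x n := \sum_(i < n) (x == (d^-1 ^+ i * cs t)%g).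
have stepE n x e : ((flip s * flip t) ^+ n) (x, e) =
    (d ^+ n * x * d^-1 ^+ n, e (+) odd (c x (n + n))).
  elim: n => [|n IHn]; first by rewrite /c big_ord0 /= !expg0 mul1g mulg1 addbF.
  rewrite expgS /= IHn /flip_fun /=; congr (_, _).
    rewrite expgS [in RHS]expgSr dV /d -!mulgA //.
  rewrite addnS addSn /c !big_ord_recr /=.
  rewrite !oddD !oddb !addbA conjE -mulgA tdX mulgA -expgnDr; congr (_ (+) _).
  have -> y : (cs t * y * cs t == cs s) = (y == cs t * cs s * cs t).
    by apply/eqP/eqP => [<-|->]; rewrite -!mulgA cox_gen2 mulg1 cox_genK.
  rewrite conjE -dV -!mulgA tdX [in RHS]expgS expgnDr [in RHS]mulgA.
  by rewrite -expgS expgSr -!mulgA.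
apply: symP => -[x e]; rewrite stepE expVgn dm invg1 mul1g mulg1.
congr (_, _); rewrite /c big_split_ord /=.
under [X in _ + X]eq_bigr => i _ do rewrite expgnDr expVgn dm invg1 mul1g.
by rewrite addnn odd_double addbF.
Qed.

(** The parity of the number of positions of [a] at which right multiplication by [x] erases the
    letter. *)
Fixpoint flips a x := 
  if a is s :: a' then flips a' x (+) (wprod a' * x * (wprod a')^-1 == cs s)
  else false.

(** The parity is the change of sheet in the action of [wprod a] on [W * bool]. *)
Lemma flips_eq a b x : wprod a = wprod b -> flips a x = flips b x.
Proof.
have [F [[FM Fs] _]] := cox_univ cs flip_rel.
have F1 : F 1 = 1 by apply: (mulgI (F 1)); rewrite -FM !mulg1.
have FE c e : F (wprod c) (x, e) = (wprod c * x * (wprod c)^-1, e (+) flips c x).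
  elim: c e => [|s c IHc] e /=; first by rewrite F1 mul1g invg1 mulg1 addbF.
  rewrite FM /= Fs IHc /= /flip_fun /= addbA; congr (_, _).
  by rewrite invgM cox_genV !mulgA.
by move=> ab; have := FE a false; rewrite ab FE => -[].
Qed.

Lemma flips_rcons a s x :
  flips (rcons a s) x = (x == cs s) (+) flips a (cs s * x * cs s).
Proof.
elim: a => [|t a IHa] /=; first by rewrite mul1g invg1 mulg1 addbF.
by rewrite IHa addbA wprod_rcons invgM cox_genV !mulgA.
Qed.

Lemma flips_delete a s : flips a (cs s) ->
  exists b r c, a = b ++ r :: c /\ wprod a * cs s = wprod (b ++ c).
Proof.
elim: a => [//|r a IHa] /=; have [/IHa [b [q [c [-> e]]]] _|_] := boolP (flips a _).
  by exists (r :: b), q, c; split=> //=; rewrite -mulgA e.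
move=> /eqP e; exists [::], r, a; split=> //=.
by rewrite -e -!mulgA (mulgA _ (wprod a) (cs s)) mulVg mul1g cox_gen2 mulg1.
Qed.

Lemma flips_delete_len a s : flips a (cs s) -> size a = len (wprod a) ->
  len (wprod a * cs s) < len (wprod a).
Proof.
move=> /flips_delete [b [r [c [-> ->]]]] <-.
by rewrite (leq_ltn_trans (len_wprod _)) // !size_cat addnS.
Qed.

(** An odd parity erases a letter from a reduced word of the element. If the parity is even, it is
    odd once [s] is appended, so [s] shortens [wprod a * cs s] back to [wprod a]. *)
Lemma flips_len a s : flips a (cs s) = (len (wprod a * cs s) < len (wprod a)).
Proof.
have lt b t : flips b (cs t) -> len (wprod b * cs t) < len (wprod b).
  have [c sc ec] := reduced_word (wprod b).
  by rewrite (flips_eq _ (esym ec)) -ec => /flips_delete_len; apply; rewrite ec.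
apply/idP/idP => [/lt//|]; apply: contraTT => flipsN; rewrite -leqNgt ltnW //.
have /lt : flips (rcons a s) (cs s).
  by rewrite flips_rcons eqxx cox_gen2 mul1g addTb.
by rewrite wprod_rcons -mulgA cox_gen2 mulg1.
Qed.

(** Appending [s] toggles the parity, so [s] shortens exactly one of [w] and [w * cs s]. *)
Lemma len_mulr w s : len (w * cs s) = (len w).+1 \/ len w = (len (w * cs s)).+1.
Proof.
have le := len_mulr_le w s; have := len_mulr_le (w * cs s) s; rewrite cox_genKr.
have [a ea] := wprod_surj w.
have := flips_rcons a s (cs s); rewrite eqxx cox_gen2 mul1g !flips_len.
rewrite wprod_rcons cox_genKr ea addTb.
by move: (len w) (len (w * _)) le => m n; case: (ltngtP m n) => // *; lia.
Qed.

Lemma len_mull s w : len (cs s * w) = (len w).+1 \/ len w = (len (cs s * w)).+1.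
Proof.
have e : len (w^-1 * cs s) = len (cs s * w) by rewrite -lenV invgM invgK cox_genV.
by have := len_mulr w^-1 s; rewrite e lenV.
Qed.

Lemma exchange_right a s : len (wprod a * cs s) < len (wprod a) ->
  exists b r c, a = b ++ r :: c /\ wprod a * cs s = wprod (b ++ c).
Proof. by rewrite -flips_len => /flips_delete. Qed.

Lemma exchange_left s a : len (cs s * wprod a) < len (wprod a) ->
  exists b r c, a = b ++ r :: c /\ cs s * wprod a = wprod (b ++ c).
Proof.
move=> lt; have [|b [r [c [ea e]]]] := @exchange_right (rev a) s.
  by rewrite wprod_rev -{1}(cox_genV s) -invgM !lenV.
exists (rev c), r, (rev b); split.
  by rewrite -[a]revK ea rev_cat rev_cons -cats1 -catA.
apply: invg_inj; rewrite invgM cox_genV -wprod_rev e.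
by rewrite -rev_cat wprod_rev invgK.
Qed.

Lemma len_gen s : len (cs s) = 1%N.
Proof. by case: (len_mulr 1 s); rewrite mul1g len1. Qed.

(** The folding condition. Exchange [t] against [s] followed by a reduced word of [w]: erasing the
    initial [s] gives the equality, while erasing a later letter would make [w * cs t] shorter than
    [w]. *)
Lemma len_fold s t w : len (cs s * w) = (len w).+1 -> len (w * cs t) = (len w).+1 ->
  len (cs s * w * cs t) <= len w -> cs s * w = w * cs t.
Proof.
move=> ls lt lst; have [a sa ea] := reduced_word w.
have [|b [r [c [eb e]]]] := @exchange_right (s :: a) t; first by rewrite /= ea ls ltnS.
case: b eb e => [|q b] /= [].
  by move=> _ <-; rewrite ea => e; rewrite -[in RHS]e cox_genKr.
move=> <- eb; rewrite ea -mulgA => /mulgI e; move: (len_wprod (b ++ c)).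
by rewrite -e lt -sa eb !size_cat addnS ltnNge leqnSn.
Qed.

(** * Parabolic subgroups *)

Fixpoint letters a : set S :=
  if a is s :: a' then s |` letters a' else set0.

Lemma letters_cat a b : letters (a ++ b) = letters a `|` letters b.
Proof. by elim: a => [|s a IHa] /=; rewrite ?set0U // IHa setUA. Qed.

Lemma letters_rcons a s : letters (rcons a s) = letters a `|` [set s].
Proof. by rewrite -cats1 letters_cat /= setU0. Qed.

Lemma letters_rev a : letters (rev a) = letters a.
Proof.
by elim: a => [|s a IHa] //; rewrite rev_cons letters_rcons IHa setUC.
Qed.

Lemma letters_delete a b r : letters (a ++ b) `<=` letters (a ++ r :: b).
Proof. by rewrite !letters_cat /= => s [] ?; [left | right; right]. Qed.

Lemma finite_letters a : finite_set (letters a).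
Proof.
by elim: a => [|s a IHa] /=; [exact: finite_set0 | rewrite finite_setU].
Qed.

Lemma para_gen I s : I s -> parabolic cs I (cs s).
Proof. by move=> Is; apply: sub_subgroup_gen; exists s. Qed.

Lemma paraM I x y : parabolic cs I x -> parabolic cs I y -> parabolic cs I (x * y).
Proof. by apply: subgroupM; exact: subgroup_genP. Qed.

Lemma paraV I x : parabolic cs I x -> parabolic cs I x^-1.
Proof. by apply: subgroupV; exact: subgroup_genP. Qed.

Lemma paraP I w :
  parabolic cs I w <-> exists2 a, letters a `<=` I & wprod a = w.
Proof.
split=> [|[a aI <-]]; last first.
  elim: a aI => [_|s a IHa]; first exact: (subgroup_genP _).1.
  by rewrite subUset sub1set inE => -[Is aI]; exact: paraM (para_gen Is) (IHa aI).
apply: (subgroup_gen_sub (A := [set w | _])); last first.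
  by move=> _ [s Is <-]; exists [:: s]; rewrite /= ?mulg1 // setU0 sub1set inE.
split=> [|_ _ [a aI <-] [b bI <-]]; first by exists [::].
exists (a ++ rev b); first by rewrite letters_cat letters_rev subUset.
by rewrite wprod_cat wprod_rev.
Qed.

Lemma para_sub I J : I `<=` J -> parabolic cs I `<=` parabolic cs J.
Proof.
move=> IJ; apply: subgroup_gen_sub; first exact: subgroup_genP.
by move=> _ [s /IJ Js <-]; exact: para_gen.
Qed.

Lemma para_commute I x y : (forall s, I s -> commute x (cs s)) ->
  parabolic cs I y -> commute x y.
Proof.
move=> Ix; move: y; apply: (subgroup_gen_sub (A := commute x)).
  by split=> [|y z xy xz]; [exact: commute1 | exact/commuteM/commuteV].
by move=> _ [s Is <-]; exact: Ix.
Qed.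

(** Letters are appended one by one; when a letter shortens the product, exchange erases a letter
    and so stays among the words in [I]. *)
Lemma para_reduced I w : parabolic cs I w ->
  exists a, [/\ letters a `<=` I, size a = len w & wprod a = w].
Proof.
move/paraP => [a aI <-]; elim/last_ind: a aI => [|a s IHa].
  by move=> _; exists [::]; split; rewrite /= ?len1.
rewrite letters_rcons subUset sub1set inE wprod_rcons => -[/IHa{IHa} [b [bI sb eb]] Is].
rewrite -eb in sb *.
have [l|l] := len_mulr (wprod b) s.
  exists (rcons b s); rewrite wprod_rcons letters_rcons size_rcons sb l.
  by split=> //; rewrite subUset sub1set inE.
have [|c [r [d [ebd e]]]] := @exchange_right b s; first by rewrite [X in _ < X]l.
exists (c ++ d); split=> //.
  by apply: subset_trans bI; rewrite ebd; exact: letters_delete.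
by apply: succn_inj; rewrite -l -sb ebd !size_cat addnS.
Qed.

Lemma reduced_behead s a : size (s :: a) = len (wprod (s :: a)) ->
  size a = len (wprod a).
Proof.
move=> sa; apply/eqP; rewrite eqn_leq len_wprod andbT -ltnS -/(size (s :: a)) sa.
exact: len_mull_le.
Qed.

(** Exchanging the first letter of [a] against a reduced word in [I] puts this letter in [W_I] and
    leaves a reduced word in [I] for the rest. *)
Lemma para_letters I a : parabolic cs I (wprod a) -> size a = len (wprod a) ->
  letters a `<=` I.
Proof.
move=> /para_reduced [b [bI sb eb]] sa.
elim: a b bI sb eb sa => [|s a IHa] b bI sb eb sa; first exact: sub0set.
have la := reduced_behead sa.
have e : cs s * wprod b = wprod a by rewrite eb /= cox_genK.
have [|c [r [d [ebd e']]]] := @exchange_left s b.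
  by rewrite e eb -sa -la.
have cdI : letters (c ++ d) `<=` I.
  by apply: subset_trans bI; rewrite ebd; exact: letters_delete.
rewrite subUset sub1set inE; split.
  have : parabolic cs I (cs s).
    rewrite -[cs s](mulgK (wprod b)) e'.
    apply: paraM; first by apply/paraP; exists (c ++ d).
    by apply: paraV; apply/paraP; exists b.
  move=> /para_reduced [t [tI]]; rewrite len_gen.
  by case: t tI => [|t []] //= tI _; rewrite mulg1 => /(@cox_gen_inj _ _ _ cs) <-;
    apply: tI; left.
apply: (IHa (c ++ d)) => //; last by rewrite -e' e.
by apply: succn_inj; rewrite -la -/(size (s :: a)) sa -sb ebd !size_cat addnS.
Qed.

Lemma para_geni I s : parabolic cs I (cs s) -> I s.
Proof.
move=> Is; apply: (@para_letters I [:: s]); rewrite /= ?mulg1 ?len_gen //.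
by left.
Qed.

(** If [r] shortened [w], exchange would put [cs r] in [W_I]. *)
Lemma len_mull_para I r w : ~ I r -> parabolic cs I w ->
  len (cs r * w) = (len w).+1.
Proof.
move=> Ir Iw; have [//|l] := len_mull r w; case: Ir; apply: para_geni.
have [a [aI sa ea]] := para_reduced Iw; rewrite -ea in l Iw *.
have [|b [t [c [ebc e]]]] := @exchange_left r a; first by rewrite [X in _ < X]l.
rewrite -[cs r](mulgK (wprod a)) e; apply: paraM (paraV Iw).
by apply/paraP; exists (b ++ c) => //; apply: subset_trans aI; rewrite ebc;
   exact: letters_delete.
Qed.

Lemma len_mulr_para I r w : ~ I r -> parabolic cs I w ->
  len (w * cs r) = (len w).+1.
Proof.
move=> Ir Iw; have := len_mull_para Ir (paraV Iw).
by rewrite lenV -{1}(cox_genV r) -invgM lenV.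
Qed.

Lemma cat_eq_cons a b c r d : a ++ b = c ++ r :: d ->
  (exists2 d', a = c ++ r :: d' & d = d' ++ b) \/
  (exists2 c', b = c' ++ r :: d & c = a ++ c').
Proof.
elim: a c => [|s a IHa] [|t c] /=; try by move=> ->; right; exists [::].
- by move=> ->; right; exists (t :: c).
- by case=> -> <-; left; exists a.
case=> -> /IHa [[d' -> ->]|[c' -> ->]]; first by left; exists d'.
by right; exists c'.
Qed.

(** If a further letter [s] of [k] shortened the product, exchange would erase a letter in the word
    of [k], which is reduced, or one in the word of [y], which would give a shorter element of the
    coset [W_I y]. *)
Lemma len_para_min I k y :
    (forall x, parabolic cs I x -> len y <= len (x * y)) ->
  parabolic cs I k -> len (k * y) = len k + len y.
Proof.
move=> ymin /para_reduced [a [aI sa ek]]; subst k; rewrite -sa.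
have [b sb eb] := reduced_word y.
elim: a aI sa => [|s a IHa]; first by rewrite mul1g.
rewrite subUset sub1set inE => -[Is aI] sa.
have la := reduced_behead sa; have {}IHa := IHa aI la.
rewrite /= -mulgA; have [->|l] := len_mull s (wprod a * y); first by rewrite IHa.
have [|c [r [d [ecd e]]]] := @exchange_left s (a ++ b).
  by rewrite wprod_cat eb [X in _ < X]l.
move: e; rewrite !wprod_cat eb.
have [[d' ea ->]|[c' ebc ->]] := cat_eq_cons ecd.
  rewrite wprod_cat eb mulgA mulgA => /mulIg e.
  have := len_wprod (c ++ d'); rewrite wprod_cat -e -sa /= ea !size_cat /=; lia.
rewrite wprod_cat -mulgA => e.
have ya : (wprod a)^-1 * cs s * wprod a * y = wprod (c' ++ d).
  by rewrite -!mulgA e mulKg wprod_cat.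
have : len y <= len (wprod (c' ++ d)).
  rewrite -ya; apply: ymin; have aP : parabolic cs I (wprod a) by apply/paraP; exists a.
  exact: paraM (paraM (paraV aP) (para_gen Is)) aP.
have := len_wprod (c' ++ d); rewrite -sb ebc !size_cat /=; lia.
Qed.

Lemma para_min_exists I z : exists k y, [/\ parabolic cs I k, z = k * y &
  forall x, parabolic cs I x -> len y <= len (x * y)].
Proof.
pose P n := `[< exists2 k, parabolic cs I k & len (k * z) = n >].
have I1 : parabolic cs I 1 := (subgroup_genP _).1.
have exP : exists n, P n by exists (len (1 * z)); apply/asboolP; exists 1.
case: (ex_minnP exP) => n /asboolP [k kI <-] nmin.
exists k^-1, (k * z); split; [exact: paraV | by rewrite mulKg |].
by move=> x xI; apply/nmin/asboolP; exists (x * k); [exact: paraM | rewrite mulgA].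
Qed.

(** Let [y = k0 * y0] with [y0] minimal in its coset. The first letter of a reduced word of [k0]
    would shorten [y], so [k0 = 1]. *)
Lemma len_para_asc I k y : (forall s, I s -> len y < len (cs s * y)) ->
  parabolic cs I k -> len (k * y) = len k + len y.
Proof.
have [k0 [y0 [/para_reduced [a [aI sa ek]] -> ymin]]] := para_min_exists I y.
subst k0.
case: a aI sa => [|s a]; first by rewrite mul1g => _ _ _; exact: len_para_min.
rewrite subUset sub1set inE => -[Is aI] sa /(_ _ Is) /=.
have aP : parabolic cs I (wprod a) by apply/paraP; exists a.
rewrite -mulgA cox_genK mulgA !(len_para_min ymin) //;
  last exact: paraM (para_gen Is) aP.
by rewrite -(reduced_behead sa) -sa /= ltn_add2r ltnNge leqnSn.
Qed.

(** Both [r] and [s] shorten [z = r s n = s n r] from the left, hence also its factor [d] in the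
    dihedral subgroup generated by [r] and [s]. If [d] has length 2, then [d = r s = s r]. If it is
    longer, it has a reduced word beginning with [r s r], so that [r] shortens [n], against
    [len_mull_para]. *)
Lemma commute_head I r s n : ~ I r -> I s -> parabolic cs I n ->
    len (cs s * n) = (len n).+1 -> commute (cs r) (cs s * n) ->
  commute (cs r) (cs s).
Proof.
move=> Ir Is In ln rn; pose D := [set r; s]; pose z := cs r * (cs s * n).
have rs : cs r <> cs s by move=> /(@cox_gen_inj _ _ _ cs) e; apply: Ir; rewrite e.
have lz : len z = (len n).+2.
  by rewrite /z (len_mull_para Ir) ?ln //; exact: paraM (para_gen Is) In.
have [d [y [Dd ez ymin]]] := para_min_exists D z.
have Dr : parabolic cs D (cs r) by apply: para_gen; left.
have Ds : parabolic cs D (cs s) by apply: para_gen; right.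
have ld := len_para_min ymin Dd; have lrd := len_para_min ymin (paraM Dr Dd).
have lsd := len_para_min ymin (paraM Ds Dd).
rewrite -ez lz in ld; rewrite -mulgA -ez /z cox_genK ln in lrd.
have {}lsd : len (cs s * d) + len y <= (len n).+1.
  by rewrite -lsd -mulgA -ez /z rn -!mulgA cox_genK len_mulr_le.
have [e [De se ee]] := para_reduced (paraM Dr Dd).
have {ee} ee : d = cs r * wprod e by rewrite ee cox_genK.
case: e De se ee => [|t e] /= De se ed.
  rewrite mulg1 in ed; have /len_eq0/(congr1 (mul (cs s))) : len (cs s * d) = 0 by lia.
  by rewrite cox_genK mulg1 ed => /rs.
have le := len_wprod e.
have [et|et] : D t by apply: De; left.
  by rewrite et cox_genK in ed; rewrite ed in ld lrd se; lia.
rewrite {t}et in De se ed; case: e De se ed le => [|q e] /= De se ed le.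
  rewrite mulg1 in ed; have l1 : len (cs s * d) = 1%N.
    by have := len_mull s d; lia.
  have [[|t [|? ?]] [Dt]] := para_reduced (paraM Ds Dd); rewrite l1 //= mulg1 => _ et.
  have [e|e] : D t by apply: Dt; left.
    by rewrite /commute -ed -[d](cox_genK s) -et e.
  by move: et; rewrite e ed -[LHS]mulg1 => /mulgI/esym/(congr1 (mul (cs r)));
     rewrite cox_genK mulg1 => /esym/rs.
have [eq|eq] : D q by apply: De; right; left.
  have en : cs r * n = wprod e * y.
    rewrite -[n](cox_genK s) -[cs s * n](cox_genK r) -/z ez ed eq.
    by rewrite -!mulgA !cox_genK.
  have := len_mull_para Ir In; rewrite en; have := lenM (wprod e) y.
  have := len_wprod e; lia.
by rewrite eq cox_genK in ed; have := len_mull_le r (wprod e);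
   have := len_wprod e; rewrite -ed; lia.
Qed.

(** By [commute_head], [r] commutes with the first letter, hence with the product of the others. *)
Lemma commute_letters I r a : ~ I r -> letters a `<=` I ->
    size a = len (wprod a) -> commute (cs r) (wprod a) ->
  forall s, letters a s -> commute (cs r) (cs s).
Proof.
move=> Ir; elim: a => [|t a IHa] //=.
rewrite subUset sub1set inE => -[It aI] sa ra.
have la := reduced_behead sa.
have aP : parabolic cs I (wprod a) by apply/paraP; exists a.
have rt : commute (cs r) (cs t).
  by apply: commute_head It aP _ ra => //; rewrite -la -sa.
move=> s [-> //|]; apply: IHa => //.
rewrite -(cox_genK t (wprod a)); exact: commuteM.
Qed.

(** * Subwords, suffixes and parabolic subgroups of finite index *)

Fixpoint subwords a : set (seq S) :=
  if a is s :: a' then subwords a' `|` (cons s @` subwords a') else [set [::]].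

Lemma finite_subwords a : finite_set (subwords a).
Proof.
elim: a => [|s a IHa] /=; first exact: finite_set1.
by rewrite finite_setU; split=> //; exact: finite_image.
Qed.

Lemma subwords_refl a : subwords a a.
Proof. by elim: a => //= s a IHa; right; exists a. Qed.

Lemma subwords_delete a b r c : subwords a (b ++ r :: c) -> subwords a (b ++ c).
Proof.
elim: a b => [|s a IHa] b; first by case: b.
case=> [ac|[d ad]]; first by left; exact: IHa ac.
case: b => [|t b] /= []; first by move=> _ <-; left.
by move=> <- e; right; exists (b ++ c) => //; apply: IHa; rewrite -e.
Qed.

Lemma subwords_trans c b a : subwords b c -> subwords a b -> subwords a c.
Proof.
elim: a b c => [|s a IHa] b c /=; first by move=> cb eb; rewrite eb in cb.
move=> cb [ab|[b' ab' eb]]; first by left; exact: IHa ab.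
move: cb; rewrite -eb /= => -[cb|[c' cb' <-]]; first by left; exact: IHa ab'.
by right; exists c' => //; exact: IHa ab'.
Qed.

Lemma reduced_belast a s : size (rcons a s) = len (wprod (rcons a s)) ->
  size a = len (wprod a).
Proof.
rewrite size_rcons wprod_rcons => sa; apply/eqP.
by rewrite eqn_leq len_wprod andbT -ltnS sa len_mulr_le.
Qed.

Section Cover.
Variables (u : W) (K : set S).
Hypothesis K_asc : forall s, K s -> len u < len (cs s * u).
Hypothesis u_top : forall q, len (u * cs q) < len u \/
  exists2 s, K s & cs s * u = u * cs q.

(* Every [z] is a suffix of [W_K u] in the weak order: [u] represents a
   longest coset in [W_K \ W]. *)
Lemma suffix_top z : exists k x, [/\ parabolic cs K k, k * u = x * z &
  len (k * u) = len x + len z].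
Proof.
have [a sa ea] := reduced_word z; subst z.
elim/last_ind: a sa => [|a q IHa] sa.
  exists 1, u; rewrite /= len1 !mulg1 mul1g addn0; split=> //.
  exact: (subgroup_genP _).1.
have la := reduced_belast sa; have [k [b [Kk ekb lkb]]] := IHa la.
have la1 : len (wprod (rcons a q)) = (len (wprod a)).+1.
  by rewrite -sa size_rcons la.
have ekq : k * u * cs q = b * wprod (rcons a q) by rewrite ekb wprod_rcons mulgA.
(* If [q] lengthens [k * u] it cannot shorten [u], since lengths add in [k * u]; so [u_top] turns
   [q] into a letter of [K], absorbed by [k]. *)
have [l|l] := len_mulr (k * u) q.
  have lk := len_para_asc K_asc Kk.
  have [lu|[s Ks es]] := u_top q.
    by have := lenM k (u * cs q); rewrite mulgA l lk -addnS leq_add2l ltnNge (ltnW lu).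
  have ekq' : k * cs s * u = k * u * cs q by rewrite -!mulgA es.
  exists (k * cs s), b; rewrite ekq'; split=> //; first exact: paraM (para_gen Ks).
  by rewrite l lkb la1 addnS.
(* If [q] shortens [k * u], exchange erases a letter of [c], and what remains of [c] is the new
   prefix; the erased letter cannot be in [a], because [rcons a q] is reduced. *)
have [c sc ec] := reduced_word b.
have [|d [r [f [edf e]]]] := @exchange_right (c ++ a) q.
  by rewrite wprod_cat ec -ekb [X in _ < X]l.
move: e; rewrite !wprod_cat ec -ekb => e.
have [[f' ecd ef]|[d' ead ed]] := cat_eq_cons edf.
  have ek : k * u = wprod (d ++ f') * wprod (rcons a q).
    by rewrite wprod_rcons mulgA wprod_cat -[k * u](cox_genKr q) e ef wprod_cat !mulgA.
  exists k, (wprod (d ++ f')); split=> //; apply/eqP.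
  rewrite eqn_leq {1}ek lenM lkb la1 addnS -addSn leq_add2r -sc ecd size_cat /=.
  rewrite addnS ltnS.
  by rewrite -size_cat len_wprod.
move: e; rewrite ekq ed wprod_cat ec -mulgA => /mulgI e.
have := len_wprod (d' ++ f); rewrite wprod_cat -e -sa size_rcons ead !size_cat /=; lia.
Qed.

(** Each letter of [a], taken from the left, erases by exchange a letter of [b], which remains a
    word in [K], or of [c], of which a subword remains. *)
Lemma suffix_subword a b c z : letters b `<=` K ->
    wprod b * wprod c = wprod a * z -> len (wprod a * z) = size a + len z ->
  exists b' c', [/\ letters b' `<=` K, subwords c c' & z = wprod b' * wprod c'].
Proof.
elim: a b c => [|s a IHa] b c bK /=.
  by rewrite mul1g => <- _; exists b, c; split=> //; exact: subwords_refl.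
rewrite -mulgA => e l.
have l' : len (wprod a * z) = size a + len z.
  have := lenM (wprod a) z; have := len_wprod a; have := len_mull_le s (wprod a * z).
  rewrite l; lia.
have [|d [r [f [edf e']]]] := @exchange_left s (b ++ c).
  by rewrite wprod_cat e cox_genK l l' addSn.
rewrite wprod_cat e cox_genK in e'.
have [[f' eb ef]|[d' ec ed]] := cat_eq_cons edf.
  have [||b' [c' [b'K c'c ->]]] := IHa (d ++ f') c _ _ l'.
  - by apply: subset_trans bK; rewrite eb; exact: letters_delete.
  - by rewrite e' ef !wprod_cat mulgA.
  by exists b', c'.
have [||b' [c' [b'K c'c ->]]] := IHa b (d' ++ f) _ _ l' => //.
  by rewrite e' ed !wprod_cat mulgA.
exists b', c'; split=> //; apply: subwords_trans c'c _.
by rewrite ec; apply: subwords_delete (subwords_refl _).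
Qed.

(** The products of the subwords of a single reduced word of [u] represent all the cosets of
    [W_K]. *)
Lemma finite_cover : exists2 F : set W, finite_set F &
  forall z, exists k f, [/\ parabolic cs K k, F f & z = k * f].
Proof.
have [c sc ec] := reduced_word u.
exists (wprod @` subwords c); first exact/finite_image/finite_subwords.
move=> z; have [k [x [Kk e l]]] := suffix_top z.
have [a sa ea] := reduced_word x; have [b [bK sb eb]] := para_reduced Kk.
have [||b' [c' [b'K c'c ->]]] := @suffix_subword a b c z bK.
- by rewrite eb ec ea.
- by rewrite ea sa -e l.
exists (wprod b'), (wprod c'); split=> //; by apply/paraP; exists b'.
Qed.

End Cover.

(** * Finite twisted conjugacy classes *)

Section Diagram.
Variables (F : W -> W) (tau : S -> S).
Hypothesis FM : {morph F : x y / x * y}.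
Hypothesis Ftau : forall s, F (cs s) = cs (tau s).

Lemma wprod_map a : F (wprod a) = wprod (map tau a).
Proof.
elim: a => [|s a IHa] /=; last by rewrite FM Ftau IHa.
by apply: (mulgI (F 1)); rewrite -FM !mulg1.
Qed.

Lemma len_map_le x : len (F x) <= len x.
Proof.
by have [a <- <-] := reduced_word x; rewrite wprod_map -(size_map tau) len_wprod.
Qed.

Hypothesis F2 : involutive F.
Variable w : W.
Hypothesis wF : w * F w = 1.
Hypothesis class_fin : finite_set (range (fun v => v * w * (F v)^-1)).

Let tau2 s : tau (tau s) = s.
Proof. by apply: (@cox_gen_inj _ _ _ cs); rewrite -!Ftau F2. Qed.

Let F1 : F 1 = 1.
Proof. by apply: (mulgI (F 1)); rewrite -FM !mulg1. Qed.

Let FV x : F x^-1 = (F x)^-1.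
Proof. by apply: (mulgI (F x)); rewrite -FM !mulgV. Qed.

Let lenF x : len (F x) = len x.
Proof. by apply/eqP; rewrite eqn_leq len_map_le -{1}[x]F2 len_map_le. Qed.

Let longest : exists v u, u = v * w * (F v)^-1 /\
  forall x, len (x * u * (F x)^-1) <= len u.
Proof.
pose P n := `[< exists v, len (v * w * (F v)^-1) = n >].
have exP : exists n, P n by exists (len (1 * w * (F 1)^-1)); apply/asboolP; exists 1.
have /finite_seqP [ls els] : finite_set (range (fun v => len (v * w * (F v)^-1))).
  by rewrite -(image_comp (fun v => v * w * (F v)^-1)); exact: finite_image.
have bnd n : P n -> n <= \max_(m <- ls) m.
  move/asboolP => [v nv]; have nl : [set` ls] n by rewrite -els; exists v.
  exact: (leq_bigmax_seq (F := id) n nl isT).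
have [n /asboolP [v <-] nmax] := ex_maxnP exP bnd.
exists v, (v * w * (F v)^-1); split=> // x.
apply/nmax/asboolP; exists (x * v); by rewrite FM invgM !mulgA.
Qed.

Lemma twisted_conj_rigid : exists I : set S,
  [/\ finite_set (parabolic cs I),
      forall r s, I r -> ~ I s -> commute (cs r) (cs s),
      forall s, ~ I s -> tau s = s &
      parabolic cs I w].
Proof.
have [v [u [uw umax]]] := longest.
have uF : u * F u = 1.
  by rewrite uw !FM FV F2 !mulgA mulgVK -(mulgA v) wF mulg1 mulgV.
pose K := [set s | len u < len (cs s * u)].
(* Inversion sends [u * cs (tau s)] to [F (cs s * u)], because [u^-1 = F u]. *)
have len_tau s : len (u * cs (tau s)) = len (cs s * u).
  by rewrite -lenV invgM cox_genV (mulg1_eq uF) -Ftau -FM lenF.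
have fold s : K s -> cs s * u = u * cs (tau s).
  rewrite /K /=; case: (len_mull s u) => [l _|->]; last by rewrite ltnNge leqnSn.
  apply: len_fold; rewrite ?len_tau //.
  by have := umax (cs s); rewrite Ftau cox_genV.
have top q : len (u * cs q) < len u \/ exists2 s, K s & cs s * u = u * cs q.
  rewrite -[q]tau2 len_tau; have [l|l] := len_mull (tau q) u;
    last by left; rewrite [X in _ < X]l.
  have Kq : K (tau q) by rewrite /K /= l.
  by right; exists (tau q) => //; exact: fold.
have [C finC cover] := finite_cover (fun s Ks => Ks : len u < len (cs s * u)) top.
have sK : is_subgroup (parabolic cs K) := subgroup_genP _.
pose N := [set n | forall v, parabolic cs K (v * n / v)].
pose K0 := [set s | exists a, [/\ N (wprod a), size a = len (wprod a) & letters a s]].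
have K0_K : K0 `<=` K.
  move=> s [a [Na sa]]; apply: para_letters sa _.
  by have := Na 1; rewrite mul1g invg1 mulg1.
have N_K0 n : N n -> parabolic cs K0 n.
  have [a sa ea] := reduced_word n; subst n => Na.
  by apply/paraP; exists a => // s as_; exists a.
(* Multiplication by [r] lengthens [n] on either side and [r n r] on the right; so [r n r] is as
   long as [n], and the folding condition applies with [r] on both sides. *)
have N_comm r n : ~ K0 r -> N n -> commute (cs r) n.
  move=> K0r Nn; have Nrn : N (cs r * n * cs r).
    by move=> x; have := Nn (x * cs r); rewrite invgM cox_genV !mulgA.
  have l1 := len_mull_para K0r (N_K0 _ Nn); have l2 := len_mulr_para K0r (N_K0 _ Nn).
  have := len_mulr_para K0r (N_K0 _ Nrn); rewrite cox_genKr l1 => -[l3].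
  by apply: len_fold => //; rewrite -l3.
have K0_comm r s : ~ K0 r -> K0 s -> commute (cs r) (cs s).
  move=> K0r [a [Na sa as_]].
  apply: (commute_letters K0r _ sa (N_comm _ _ K0r Na)) => //.
  by apply: para_letters sa; exact: N_K0.
pose I := ~` K0.
have II r : ~ I r -> K0 r by move=> /contrapT.
have nI s : K0 s -> ~ I s by move=> Ks Is; exact: Is.
have para_comm k f : parabolic cs K0 k -> parabolic cs I f -> commute k f.
  move=> Kk; apply: para_commute => r Ir; apply/commute_sym; apply: para_commute Kk.
  by move=> s; exact: K0_comm.
have decomp x : exists k f, [/\ parabolic cs K0 k, parabolic cs I f & x = k * f].
  have [a <-] := wprod_surj x; elim: a => [|s a [k [f [Kk If e]]]] /=.
    by exists 1, 1; split; rewrite ?mulg1 //; exact: (subgroup_genP _).1.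
  have [Ks|Is] := pselect (K0 s).
    by exists (cs s * k), f; rewrite e mulgA; split=> //; exact: paraM (para_gen Ks) Kk.
  have If' : parabolic cs I (cs s) by exact: para_gen.
  exists k, (cs s * f); split=> //; first exact: paraM.
  by rewrite e !mulgA (para_comm k).
(* No letter of [K0] shortens [u] or [f] from the left, so [len f = len k + len u] and
   [len u = len k + len f], which forces [k = 1]. *)
have Iu : parabolic cs I u.
  have [k [f [Kk If e]]] := decomp u.
  have lf : len f = len k + len u.
    rewrite -(lenV k) -(len_para_asc (I := K0) _ (paraV Kk)) ?e ?mulKg // => s /K0_K.
    by rewrite /K /= e.
  have lu : len u = len k + len f.
    rewrite e; apply: len_para_asc Kk => s Ks.
    by rewrite (len_mull_para (nI _ Ks) If).
  have /len_eq0 k1 : len k = 0 by lia.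
  by rewrite e k1 mul1g.
have tauK0 s : ~ I s -> tau s = s.
  move=> /II Ks; apply: (@cox_gen_inj _ _ _ cs); apply: (mulgI u).
  by rewrite -fold ?(para_comm (cs s) u) //; [exact: para_gen | exact: K0_K].
exists I; split=> //.
(* When [x / y] lies in the core [N], the letters of its reduced words belong both to [K0] and to
   its complement [I], so there are none. *)
- apply: (finite_mod_core sK finC cover) => x y Ix Iy Nxy.
  apply: divg1_eq; have [a sa ea] := reduced_word (x / y).
  have aK0 : letters a `<=` K0 by apply: para_letters; rewrite ea //; exact: N_K0.
  have aI : letters a `<=` I.
    by apply: para_letters; rewrite ea //; exact: paraM (paraV _).
  rewrite -ea; case: a {sa ea} aK0 aI => //= s a aK0 aI.
  by have := aI s (or_introl erefl); case; apply: aK0; left.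
- by move=> r s Ir /II; exact: K0_comm.
have I_tau r : I r -> I (tau r).
  by move=> Ir Kr; apply: Ir; have := tauK0 (tau r); rewrite tau2 => ->.
have [k [f [Kk If e]]] := decomp v.
have Fk : F k = k.
  case/paraP: Kk => a aK0 ea; rewrite -ea wprod_map; congr (wprod _).
  elim: a aK0 {ea} => //= s a IHa; rewrite subUset sub1set inE => -[Ks /IHa ->].
  by rewrite tauK0 //; exact: nI.
have FI x : parabolic cs I x -> parabolic cs I (F x).
  case/paraP => a aI <-; rewrite wprod_map; apply/paraP; exists (map tau a) => //.
  elim: a aI => //= s a IHa; rewrite !subUset !sub1set !inE => -[Is /IHa].
  by split=> //; exact: I_tau.
(* The factor [k] of [v] is fixed by [F] and commutes with [u], so it cancels in
   [v^-1 * u * F v]. *)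
have -> : w = f^-1 * u * F f.
  have -> : w = v^-1 * u * F v by rewrite uw -!mulgA mulKg mulVg mulg1.
  rewrite e FM Fk invgM !mulgA; congr (_ * _); rewrite -!mulgA; congr (_ * _).
  by rewrite -(para_comm k u) // mulKg.
exact: paraM (paraM (paraV If) Iu) (FI _ If).
Qed.
End Diagram.
End Words.

(** * Components and semidirect products *)

Section Components.
Variables (S : Type) (M : coxeter_matrix S) (W : groupType).
Variable cs : coxeter_system M W.
Implicit Types (s t r : S) (I : set S).
Local Notation comp := (graph_component M).
Local Notation Wcomp s := (parabolic cs (graph_component M s)).

Lemma cox_edgeC s t : cox_edge M s t = cox_edge M t s.
Proof. by rewrite /cox_edge cox_mC. Qed.

Lemma component_refl s : comp s s.
Proof. by exists [::]. Qed.

Lemma component_edge s t r : comp s t -> cox_edge M t r -> comp s r.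
Proof.
move=> [p sp ->] tr; exists (rcons p r); last by rewrite last_rcons.
by rewrite rcons_path sp.
Qed.

Lemma component_sub I s : (forall t r, I t -> cox_edge M t r -> I r) ->
  I s -> comp s `<=` I.
Proof.
move=> Iedge Is _ [p sp ->]; elim: p s sp Is => //= t p IHp s /andP[st tp] Is.
exact/(IHp _ tp)/(Iedge s).
Qed.

(** A generator outside the component commutes with all of it. *)
Lemma Wcomp_normal s v x : Wcomp s x -> Wcomp s (v * x / v).
Proof.
have [a <-] := wprod_surj cs v; elim: a x => [|r a IHa] x Cx /=.
  by rewrite invg1 mulg1 mul1g.
have -> : cs r * wprod cs a * x / (cs r * wprod cs a) =
  cs r * (wprod cs a * x / wprod cs a) * cs r by rewrite invgM cox_genV !mulgA.
have {IHa Cx} := IHa x Cx; move: (_ * x / _) => y Cy.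
have [Cr|Cr] := pselect (comp s r).
  exact: paraM (paraM (para_gen Cr) Cy) (para_gen Cr).
rewrite (para_commute _ Cy) ?cox_genKr // => t Ct.
apply: cox_edgeN => [e|]; first by apply: Cr; rewrite e.
by apply/negP => rt; apply: Cr; apply: component_edge Ct _; rewrite cox_edgeC.
Qed.

End Components.

Section SemidirectGroup.
Variables (W G : groupType) (phi : {multiplicative G -> group_aut W}).
Implicit Types (w v x y : W) (g h : G).

Lemma group_autV (f : group_aut W) x : f x^-1 = (f x)^-1.
Proof. by apply: (mulgI (f x)); rewrite -group_autM !mulgV group_aut1. Qed.

Definition sdl w := SDPair phi w 1.
Definition sdr g := SDPair phi 1 g.

Lemma sd_mulE w v g h :
  SDPair phi w g * SDPair phi v h = SDPair phi (w * phi g v) (g * h).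
Proof. by []. Qed.

Lemma sdlM : {morph sdl : x y / x * y}.
Proof. by move=> x y; rewrite /sdl sd_mulE phi1 mulg1. Qed.

Lemma sdrM : {morph sdr : x y / x * y}.
Proof. by move=> x y; rewrite /sdr sd_mulE group_aut1 mulg1. Qed.

Lemma sdlr w g : SDPair phi w g = sdl w * sdr g.
Proof. by rewrite /sdl /sdr sd_mulE phi1 mulg1 mul1g. Qed.

Lemma sd_conjE v h w g : SDPair phi v h * SDPair phi w g / SDPair phi v h =
  SDPair phi (v * phi h w * phi (h * g / h) v^-1) (h * g / h).
Proof.
rewrite -[(SDPair phi v h)^-1]/(SDPair phi (phi h^-1 v^-1) h^-1) !sd_mulE.
by rewrite -[phi (h * g) _]phiM.
Qed.

Lemma sd_set_subgroup (A : set W) (B : set G) : is_subgroup A -> is_subgroup B ->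
  (forall g w, A w -> A (phi g w)) -> is_subgroup (sd_set (phi := phi) A B).
Proof.
move=> sA sB AG; split=> [|[w g] [v h] [/= Aw Bg] [/= Av Bh]].
  by split; [exact: sA.1 | exact: sB.1].
split => /=; last exact: sB.2.
by apply: (subgroupM sA) => //; apply/AG/AG; exact: subgroupV.
Qed.

End SemidirectGroup.

(** * The action on components, and sufficient conditions for being almost central *)

Section Action.
Variables (S : Type) (M : coxeter_matrix S) (W : groupType).
Variable cs : coxeter_system M W.
Variables (G : groupType) (rho : {multiplicative G -> graph_aut M}).
Implicit Types (s t r : S) (I : set S) (w v x y : W) (g h : G).
Local Notation act := (cox_act cs rho).
Local Notation comp := (graph_component M).
Local Notation Wcomp s := (parabolic cs (graph_component M s)).

Local Arguments cox_act : simpl never.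

Lemma act_gen g s : act g (cs s) = cs (rho g s).
Proof. exact: cox_ext_gen. Qed.

Lemma actK g : cancel (act g) (act g^-1).
Proof. by move=> x; rewrite -phiM mulVg phi1. Qed.

Lemma actVK g : cancel (act g^-1) (act g).
Proof. by move=> x; rewrite -phiM mulgV phi1. Qed.

Lemma rhoK g : cancel (rho g) (rho g^-1).
Proof. by move=> s; apply: (@cox_gen_inj _ _ _ cs); rewrite -!act_gen actK. Qed.

Lemma len_act g x : len cs (act g x) = len cs x.
Proof.
have le h y : len cs (act h y) <= len cs y.
  by apply: len_map_le; [exact: group_autM | exact: act_gen].
by apply/eqP; rewrite eqn_leq le -{1}[x](actK g) le.
Qed.

Lemma act_Wcomp_sub g s x : Wcomp s x -> Wcomp (rho g s) (act g x).
Proof.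
move: x; apply: (subgroup_gen_sub (A := act g @^-1` Wcomp (rho g s))).
  by apply: preimage_subgroup; [exact: group_autM | exact: subgroup_genP].
move=> _ [t [p sp ->] <-]; rewrite /preimage /mkset act_gen; apply: para_gen.
exists (map (rho g) p); last by rewrite last_map.
rewrite path_map; apply: sub_path sp => a b /=.
by rewrite /cox_edge graph_aut_cox_m // graph_aut_subproof.
Qed.

Lemma act_Wcomp g s : act g @` Wcomp s = Wcomp (rho g s).
Proof.
apply/seteqP; split=> [_ [x sx <-]|x sx]; first exact: act_Wcomp_sub.
by exists (act g^-1 x); rewrite ?actVK // -[s](rhoK g); exact: act_Wcomp_sub.
Qed.

Lemma O_rho_act g C : O_rho cs rho C -> O_rho cs rho (act g @` C).
Proof.
move=> [[[s _ <-] fC] fO]; rewrite /= in fC; split.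
  by split; [exists (rho g s); rewrite ?act_Wcomp | exact: finite_image].
apply: sub_finite_set fO => _ [h _ <-]; exists (h * g) => //.
rewrite /rho_dagger image_comp; congr image; apply/funext => x.
exact: phiM.
Qed.

Lemma component_prod_act g w : component_prod (O_rho cs rho) w ->
  component_prod (O_rho cs rho) (act g w).
Proof.
move: w.
apply: (subgroup_gen_sub (A := act g @^-1` component_prod (O_rho cs rho))).
  by apply: preimage_subgroup; [exact: group_autM | exact: subgroup_genP].
move=> x [C OC Cx]; rewrite /preimage /=; apply: sub_subgroup_gen.
by exists (act g @` C); [exact: O_rho_act | exists x].
Qed.

(** The conjugates of an element of a component stay in the union of the orbit of this component,
    here a finite union of finite sets. *)
Lemma almost_central_O w : component_prod (O_rho cs rho) w ->
  almost_central (sdl act w).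
Proof.
move: w; apply: (subgroup_gen_sub (A := sdl act @^-1` @almost_central _)).
  exact: preimage_subgroup (@sdlM _ _ _) (@subgroup_almost_central _).
move=> x [C [[[s _ <-] fC] fO] Cx]; apply/almost_centralP.
have fU : finite_set (\bigcup_(D in rho_orbit cs rho (Wcomp s)) D).
  apply: bigcup_finite => // _ [g _ <-]; exact: finite_image.
apply: sub_finite_set (finite_image (sdl act) fU) => _ [[v h] _ <-].
rewrite /sdl sd_conjE mulg1 mulgV phi1; exists (v * act h x / v) => //.
exists (rho_dagger cs rho h (Wcomp s)); first by exists h.
by rewrite /rho_dagger act_Wcomp; apply: Wcomp_normal; exact: act_Wcomp_sub.
Qed.

(** The right coordinates of the conjugates are the finitely many [h * g / h], and the left ones lie
    in [R (h * g / h)], contained in the image of [R g] under [h]. The set [R g] is finite since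
    every [v] is [q * k] with [k] fixed by [g] and [q] in a finite normal subgroup containing the
    components in [E]. *)
Lemma almost_central_G_rho g : G_rho cs rho g -> almost_central (sdr act g).
Proof.
move=> [[_ /almost_centralP fg] [E [Efin fE fixg]]].
pose R h := range (fun v => v * act h v^-1).
have fR : finite_set (R g).
  have [|Q [sQ fQ nQ EQ]] := finite_normal_join fE.
    move=> C /Efin [[s _ <-] fC]; split=> //; first exact: subgroup_genP.
    exact: Wcomp_normal.
  apply: sub_finite_set (finite_image (fun q => q * act g q^-1) fQ) => _ [v _ <-].
  suff [q [k [Qq gk ->]]] : exists q k, [/\ Q q, act g k = k & v = q * k].
    exists q => //; by rewrite invgM group_autM (group_autV _ k) gk !mulgA mulgK.
  have [a <-] := wprod_surj cs v; elim: a => [|s a [q [k [Qq gk e]]]].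
    by exists 1, 1; split; [exact: sQ.1 | exact: (group_aut1 (act g)) | rewrite mulg1].
  rewrite [wprod _ _]/= e mulgA.
  have Cs : Wcomp s (cs s) by apply: para_gen; exact: component_refl.
  have [Es|Es] := pselect (E (Wcomp s)).
    by exists (cs s * q), k; split=> //; apply: (subgroupM sQ) => //; exact: EQ Cs.
  (* As [g] fixes [cs s], this generator joins the fixed factor [k] after conjugating [q]. *)
  exists (cs s * q / cs s), (cs s * k); split; first exact: nQ.
    by rewrite group_autM gk (fixg _ _ Es) //; exists s.
  by rewrite mulgA mulgVK.
have RJ h : R (h * g / h) `<=` act h @` R g.
  move=> _ [v _ <-]; exists (act h^-1 v * act g (act h^-1 v)^-1).
    by exists (act h^-1 v).
  by rewrite group_autM actVK -group_autV -!phiM.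
apply/almost_centralP.
have fU : finite_set (\bigcup_(h in range (fun z => z * g / z))
    ((fun v => SDPair act v h) @` R h)).
  apply: bigcup_finite => // _ [h _ <-]; apply: finite_image.
  exact: sub_finite_set (RJ h) (finite_image _ fR).
apply: sub_finite_set fU => _ [[v h] _ <-].
rewrite /sdr sd_conjE group_aut1 mulg1; exists (h * g / h); first by exists h.
by exists (v * act (h * g / h) v^-1) => //; exists v.
Qed.

(** * Necessary conditions for an involution to be almost central *)

Section Forward.
Variables (w : W) (g : G).
Hypothesis wg2 : involution (SDPair act w g).
Hypothesis wgAC : almost_central (SDPair act w g).

Let class := range (fun x : semidirect act => x * SDPair act w g / x).

Let class_fin : finite_set class.
Proof. exact/almost_centralP. Qed.

Let wg_wg : w * act g w = 1 /\ g * g = 1.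
Proof. by case: wg2; rewrite expg2 sd_mulE => -[]. Qed.

Lemma almost_central_right : almost_central g.
Proof.
apply/almost_centralP; apply: sub_finite_set (finite_image (@sd_right _ _ _) class_fin).
move=> _ [h _ <-]; exists (sdr act h * SDPair act w g / sdr act h).
  by exists (sdr act h).
by rewrite /sdr sd_conjE.
Qed.

(** The left coordinates of the conjugates by [W] alone form the twisted class of [w]. *)
Lemma forward_rigid : exists I : set S,
  [/\ finite_set (parabolic cs I),
      forall r s, I r -> ~ I s -> commute (cs r) (cs s),
      forall s, ~ I s -> rho g s = s &
      parabolic cs I w].
Proof.
have [wgw gg] := wg_wg.
apply: (@twisted_conj_rigid _ _ _ cs (act g)) => //.
- exact: group_autM.
- exact: act_gen.
- by move=> x; rewrite -phiM gg phi1.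
apply: sub_finite_set (finite_image (@sd_left _ _ _) class_fin).
move=> _ [v _ <-]; exists (sdl act v * SDPair act w g / sdl act v).
  by exists (sdl act v).
by rewrite /sdl sd_conjE phi1 invg1 mulg1 mul1g group_autV.
Qed.

Let edge_closed I : (forall r s, I r -> ~ I s -> commute (cs r) (cs s)) ->
  forall t r, cox_edge M t r -> I t -> I r.
Proof.
move=> Icomm t r tr It; apply: contrapT => Ir.
have := cox_gen_comm (Icomm _ _ It Ir); rewrite tr => /(_ _)/negP; apply=> // e.
by apply: Ir; rewrite -e.
Qed.

(** The exceptional components are those of the letters of [I], finitely many because the generators
    embed [I] into the finite group [W_I]. Any other component avoids [I], so [g] fixes its
    generators. *)
Lemma involution_right : (G_rho cs rho `|` [set 1]) g.
Proof.
have [_ gg] := wg_wg; have [I [fI Icomm tauI Iw]] := forward_rigid.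
have Iedge := edge_closed Icomm.
have [g1|g1] := pselect (g = 1); first by right.
left; split; first by split; [split; rewrite ?expg2 | exact: almost_central_right].
exists ((fun s => Wcomp s) @` I); split.
- move=> _ [s Is <-]; split; first by exists s.
  apply: sub_finite_set fI; apply: para_sub; apply: component_sub Is => t r It tr.
  exact: Iedge tr It.
- apply: finite_image; apply: (@finite_injective _ _ cs); last first.
    by apply: sub_finite_set fI => _ [s Is <-]; exact: para_gen.
  by move=> s t _ _; exact: cox_gen_inj.
move=> _ [s _ <-] EC; apply: (subgroup_gen_sub (A := [set x | act g x = x])).
  split=> [|x y gx gy]; first exact: (group_aut1 (act g)).
  by rewrite /mkset group_autM group_autV gx gy.
have sI : comp s `<=` ~` I.
  apply: component_sub => [t r It tr Ir|Is]; last by apply: EC; exists s.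
  by apply: It; apply: Iedge Ir; rewrite cox_edgeC.
by move=> _ [t /sI It <-]; rewrite /mkset act_gen tauI.
Qed.

(** Conjugation by [h] in [G] applies [rho h] to the letters of the reduced words of [w]. As the
    conjugates are finitely many, so are the images of each letter up to component. *)
Lemma involution_left : component_prod (O_rho cs rho) w.
Proof.
have [I [fI Icomm _ Iw]] := forward_rigid; have Iedge := edge_closed Icomm.
have [a [aI sa ea]] := para_reduced Iw.
suff aO s : letters a s -> O_rho cs rho (Wcomp s).
  rewrite -ea; elim: a aO {aI sa ea} => [|s a IHa] aO; first exact: (subgroup_genP _).1.
  apply: (subgroupM (subgroup_genP (\bigcup_(C in O_rho cs rho) C))).
    apply: sub_subgroup_gen; exists (Wcomp s); first by apply: aO; left.
    by apply: para_gen; exact: component_refl.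
  by apply: IHa => t at_; apply: aO; right.
move=> as_; split.
  split; first by exists s.
  apply: sub_finite_set fI; apply: para_sub.
  apply: component_sub (aI _ as_) => t r It tr.
  exact: Iedge tr It.
pose supp y := [set t | exists b, [/\ size b = len cs y, wprod cs b = y & letters b t]].
(* By [para_letters], all reduced words of an element have the same letters. *)
have fU : finite_set (\bigcup_(x in class) supp (sd_left x)).
  apply: bigcup_finite => // x _; have [b sb eb] := reduced_word cs (sd_left x).
  apply: sub_finite_set (finite_letters b) => t [c [sc ec ct]].
  apply: (para_letters (cs := cs) (a := c)) ct; last by rewrite ec.
  by apply/paraP; exists b => //; rewrite eb ec.
apply: sub_finite_set (finite_image (fun t => Wcomp t) fU) => _ [h _ <-].
exists (rho h s); last by rewrite /rho_dagger act_Wcomp.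
exists (sdr act h * SDPair act w g / sdr act h).
  by exists (sdr act h).
rewrite /sdr sd_conjE mul1g invg1 group_aut1 mulg1.
exists (map (rho h) a); split; first by rewrite size_map sa len_act.
  rewrite -ea (wprod_map (cs := cs) (tau := rho h)) //; first exact: group_autM.
  exact: act_gen.
elim: a as_ {aI sa ea} => //= t a IHa [->|/IHa]; first by left.
by right.
Qed.

End Forward.
End Action.

Theorem theorem3p1 (S : Type) (M : coxeter_matrix S) (W : groupType)
    (cs : coxeter_system M W) (G : groupType)
    (rho : {multiplicative G -> graph_aut M}) :
  (forall (w : W) (g : G),
     let wg := SDPair (cox_act cs rho) w g in
     involution wg ->
     (almost_central wg <->
      component_prod (O_rho cs rho) w /\ (G_rho cs rho `|` [set 1]) g)) /\
  subgroup_gen (ACI (semidirect (cox_act cs rho))) =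
    sd_set (component_prod (O_rho cs rho)) (subgroup_gen (G_rho cs rho)).
Proof.
set act := cox_act cs rho; set Orho := component_prod _.
set GG := subgroup_gen (G_rho _ _).
have part1 w g : involution (SDPair act w g) -> (almost_central (SDPair act w g) <->
    Orho w /\ (G_rho cs rho `|` [set 1]) g).
  move=> wg2; split=> [wgAC|[Ow Gg]].
    by split; [exact: involution_left wg2 wgAC | exact: involution_right wg2 wgAC].
  rewrite sdlr; apply: subgroupM; first exact: subgroup_almost_central.
    exact: almost_central_O.
  case: Gg => [|->]; first exact: almost_central_G_rho.
  exact: (subgroup_almost_central _).1.
split; first by move=> w g; exact: part1.
have sO : is_subgroup Orho := subgroup_genP _.
have sGG : is_subgroup GG := subgroup_genP _.
have sACI := subgroup_genP (ACI (semidirect act)).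
apply/seteqP; split.
  apply: subgroup_gen_sub.
    by apply: sd_set_subgroup => // g w; exact: component_prod_act.
  move=> [w g] [wg2 /(part1 _ _ wg2) [Ow Gg]]; split=> //=.
  by case: Gg => [|->]; [exact: sub_subgroup_gen | exact: sGG.1].
(* Each factor is treated on generators: the [cs t] in the components of [O_rho] and the elements of
   [G_rho] give involutions with one trivial coordinate, almost central by [part1]. *)
move=> [w g] [/= Ow Gg]; rewrite sdlr; apply: (subgroupM sACI).
  move: w Ow; apply: (subgroup_gen_sub (A := sdl act @^-1` subgroup_gen (ACI _))).
    exact: preimage_subgroup (@sdlM _ _ _) sACI.
  move=> x [C OC]; have [[[s _ Cs] _] _] := OC; rewrite -Cs in OC *.
  move: x; apply: (subgroup_gen_sub (A := sdl act @^-1` subgroup_gen (ACI _))).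
    exact: preimage_subgroup (@sdlM _ _ _) sACI.
  move=> _ [t st <-]; apply: sub_subgroup_gen.
  have t2 : involution (sdl act (cs t)).
    split; first by rewrite expg2 -sdlM cox_gen2.
    move=> /(congr1 (@sd_left _ _ _)) /= t1.
    by have := len_gen cs t; rewrite t1 len1.
  split=> //; apply/(part1 _ _ t2); split; last by right.
  by apply: sub_subgroup_gen; exists (parabolic cs (graph_component M s)) => //;
     exact: para_gen.
move: g Gg; apply: (subgroup_gen_sub (A := sdr act @^-1` subgroup_gen (ACI _))).
  exact: preimage_subgroup (@sdrM _ _ _) sACI.
move=> h Gh; apply: sub_subgroup_gen.
have h2 : involution (sdr act h).
  have [[[hh h1] _] _] := Gh; split; first by rewrite expg2 -sdrM -expg2 hh.
  by move=> /(congr1 (@sd_right _ _ _)).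
by split=> //; apply/(part1 _ _ h2); split; [exact: sO.1 | left].
Qed.
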